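(* Let $n\ge 1$. Let $V=\{v_1,\ldots,v_{2n}\}$ be $2n$ points in convex position, labeled in clockwise order, and let $P=\{p_1,\ldots,p_{n+2}\}$ be $n+2$ points in convex position, labeled in clockwise order. There exists a bijection between the set of geometric plane perfect matchings on $V$ and the set of geometric triangulations of $P$. Moreover, given an element of either set, the corresponding element of the other set can be computed in $O(n)$ time.
   Context: A geometric plane perfect matching on $V$ is a set of $n$ pairwise non-crossing straight-line segments with endpoints in $V$ such that every point of $V$ is an endpoint of exactly one segment. A geometric triangulation of $P$ is a maximal plane straight-line graph on vertex set $P$ (it contains all convex hull edges and every bounded face is a triangle). *)

(* Defs.v *)
From HB Require Import structures.
From mathcomp Require Import all_boot all_order all_algebra.
From mathcomp Require Import boolp classical_sets functions reals.

Set Implicit Arguments.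
Unset Strict Implicit.
Unset Printing Implicit Defensive.

Import Order.TTheory GRing.Theory Num.Theory.

(* A labeled point set {v_1, ..., v_m} is a family v : 'I_m -> 'rV[R]_2; label
   v_(i+1) of the text is v i. *)

Section Geometry.
Local Open Scope ring_scope.
Variables (R : realType) (m : nat).
Implicit Types (v : 'I_m -> 'rV[R]_2) (e : {set 'I_m}) (G : {set {set 'I_m}}).

Definition in_hull v (S : {set 'I_m}) (x : 'rV[R]_2) : Prop :=
  exists w : 'I_m -> R,
    [/\ forall i, 0 <= w i,
        \sum_(i in S) w i = 1 &
        x = \sum_(i in S) w i *: v i].

(* The points are distinct and are all vertices of their convex hull. *)
Definition convex_position v : Prop :=
  forall i, ~ in_hull v [set~ i] (v i).

(* Twice the signed area of the triangle p q r: negative iff p, q, r is a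
   clockwise turn. *)
Definition orient (p q r : 'rV[R]_2) : R :=
  (q 0 0 - p 0 0) * (r 0 1 - p 0 1) - (q 0 1 - p 0 1) * (r 0 0 - p 0 0).

Definition clockwise v : Prop :=
  forall i j k : 'I_m, (i < j)%N -> (j < k)%N -> orient (v i) (v j) (v k) < 0.

(* A straight-line segment with endpoints in the point set is represented by
   the two-element set of the labels of its endpoints; a straight-line graph on
   the point set is a set of such segments. *)
Definition segment v e (x : 'rV[R]_2) : Prop :=
  exists i j (t : R),
    [/\ e = [set i; j], 0 <= t <= 1 & x = (1 - t) *: v i + t *: v j].

(* Segments may meet at a common endpoint without crossing. *)
Definition crossing v e e' : Prop :=
  exists x, [/\ segment v e x, segment v e' x &
                ~ exists2 i, i \in e :&: e' & x = v i].

Definition segments G : Prop := forall e, e \in G -> #|e| = 2%N.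

Definition noncrossing v G : Prop :=
  forall e e', e \in G -> e' \in G -> e != e' -> ~ crossing v e e'.

Definition plane_graph v G : Prop :=
  [/\ segments G,
      noncrossing v G &
      forall e i, e \in G -> segment v e (v i) -> i \in e].

Definition triangulation v G : Prop :=
  plane_graph v G /\
  forall G', plane_graph v G' -> G \subset G' -> G' = G.

End Geometry.

Definition plane_perfect_matching (R : realType) (n : nat)
    (v : 'I_(2 * n) -> 'rV[R]_2) (M : {set {set 'I_(2 * n)}}) : Prop :=
  [/\ segments M, #|M| = n, noncrossing v M &
      forall i, exists! e, e \in M /\ i \in e].

(* Model of computation: a unit-cost random access machine whose programs are
   structured.  Its memory consists of registers and of arrays, all with
   entries in nat; a program names finitely many of them.  The only arithmetic
   operations are successor and (truncated) predecessor, so that t steps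
   increase the largest stored value by at most t (up to the constants of the
   program): a run of linear time only manipulates words of O(log n) bits, and
   unit costs are not abused. *)

Inductive program : Type :=
| Skip
| Const (r k : nat)            (* r := k *)
| Copy (r s : nat)             (* r := s *)
| Succ (r : nat)               (* r := r + 1 *)
| Pred (r : nat)               (* r := r - 1 *)
| Read (r a s : nat)           (* r := a[s] *)
| Write (a s r : nat)          (* a[s] := r *)
| Seq (p q : program)
| IfLt (r s : nat) (p q : program)
| WhileLt (r s : nat) (p : program).

Record state : Type := State {
  reg : nat -> nat;
  arr : nat -> nat -> nat
}.

Definition set_reg (st : state) (r x : nat) : state :=
  State (fun r' => if r' == r then x else reg st r') (arr st).

Definition set_arr (st : state) (a k x : nat) : state :=
  State (reg st)
    (fun a' k' => if (a' == a) && (k' == k) then x else arr st a' k').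

(* [exec p st t st']: started in st, p halts in st' after exactly t steps. *)
Inductive exec : program -> state -> nat -> state -> Prop :=
| exec_Skip st : exec Skip st 1 st
| exec_Const st r k : exec (Const r k) st 1 (set_reg st r k)
| exec_Copy st r s : exec (Copy r s) st 1 (set_reg st r (reg st s))
| exec_Succ st r : exec (Succ r) st 1 (set_reg st r (reg st r).+1)
| exec_Pred st r : exec (Pred r) st 1 (set_reg st r (reg st r).-1)
| exec_Read st r a s :
    exec (Read r a s) st 1 (set_reg st r (arr st a (reg st s)))
| exec_Write st a s r :
    exec (Write a s r) st 1 (set_arr st a (reg st s) (reg st r))
| exec_Seq p q st0 st1 st2 t1 t2 :
    exec p st0 t1 st1 -> exec q st1 t2 st2 ->
    exec (Seq p q) st0 (t1 + t2) st2
| exec_IfLt_true r s p q st st' t :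
    reg st r < reg st s -> exec p st t st' ->
    exec (IfLt r s p q) st t.+1 st'
| exec_IfLt_false r s p q st st' t :
    reg st s <= reg st r -> exec q st t st' ->
    exec (IfLt r s p q) st t.+1 st'
| exec_WhileLt_true r s p st0 st1 st2 t1 t2 :
    reg st0 r < reg st0 s -> exec p st0 t1 st1 ->
    exec (WhileLt r s p) st1 t2 st2 ->
    exec (WhileLt r s p) st0 (t1 + t2).+1 st2
| exec_WhileLt_false r s p st :
    reg st s <= reg st r -> exec (WhileLt r s p) st 1 st.

Section Encoding.
Variable m : nat.
Implicit Types (s : seq ('I_m * 'I_m)) (G : {set {set 'I_m}}).

(* s lists every edge of G exactly once, the edges coming in any order and the
   two endpoints of an edge in any order. *)
Definition lists s G : Prop :=
  perm_eq [seq [set p.1; p.2] | p <- s] (enum G).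

(* Register 0 holds the parameter n, register 1 the number of edges, and arrays
   0 and 1 hold the labels of the two endpoints of the successive edges;
   everything else is initially 0. *)
Definition input_state (n : nat) s : state :=
  State
    (fun r => match r with 0 => n | 1 => size s | _ => 0 end)
    (fun a k => match a with
                | 0 => nth 0 [seq val p.1 | p <- s] k
                | 1 => nth 0 [seq val p.2 | p <- s] k
                | _ => 0
                end).

Definition stores (st : state) s : Prop :=
  mkseq (fun k => (arr st 0 k, arr st 1 k)) (reg st 1)
  = [seq (val p.1, val p.2) | p <- s].

End Encoding.

Definition computes_within (p : program) (n T : nat) (m m' : nat)
    (G : {set {set 'I_m}}) (G' : {set {set 'I_m'}}) : Prop :=
  forall s, lists s G ->
    exists t st' s',
      [/\ exec p (input_state n s) t st', t <= T, stores st' s' &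
          lists s' G'].

(* Main.v *)
Require Import Defs.
From HB Require Import structures.
From mathcomp Require Import all_boot all_order all_algebra.
From mathcomp Require Import boolp classical_sets functions reals.
From mathcomp Require Import zify ring lra.

Set Implicit Arguments.
Unset Strict Implicit.
Unset Printing Implicit Defensive.

Import Order.TTheory GRing.Theory Num.Theory.

(* Both families are encoded by Dyck words of length 2n.  A noncrossing perfect
   matching is the bracket structure of its word of opening and closing points.
   For triangulations, start from the chain n < n+1 of vertices; an opening
   letter prepends the vertex preceding the head of the chain, a closing letter
   deletes the second vertex of the chain, and every letter outputs the edge
   joining the first two vertices of the new chain.  All vertices off the chain
   are then covered by an edge and the region below the chain is triangulated,
   so the word ends at the chain 0 < n+1 with a triangulation.  Conversely, a
   triangulation is produced by the greedy word that closes whenever the first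
   and the third vertex of the chain are adjacent.  The closing letters are
   also determined by the number of edges at each vertex towards larger
   vertices, so both directions are a counting or partner pass over the edges,
   in any order, followed by a run of one stack. *)

(** * Segments between points in clockwise position *)

Lemma set2_eq (T : finType) (a b c d : T) :
  [set a; b] = [set c; d] -> (a = c /\ b = d) \/ (a = d /\ b = c).
Proof.
move=> E.
have := set21 a b; have := set22 a b; have := set21 c d; have := set22 c d.
rewrite {1 2}E -{1 2}E !inE.
by move=> /orP[] /eqP ? /orP[] /eqP ? /orP[] /eqP ? /orP[] /eqP ?; intuition congruence.
Qed.

Section Crossing.
Local Open Scope ring_scope.
Variables (R : realType) (m : nat) (v : 'I_m -> 'rV[R]_2).
Implicit Types (p q r s : 'rV[R]_2).

Lemma rV2P p q : p 0 0 = q 0 0 -> p 0 1 = q 0 1 -> p = q.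
Proof.
move=> E0 E1; apply/rowP; case=> [[|[|//]] lt].
  by rewrite (_ : Ordinal lt = 0) //; apply/val_inj.
by rewrite (_ : Ordinal lt = 1) //; apply/val_inj.
Qed.

Lemma orient_conv p q r s (t : R) :
  orient p q ((1 - t) *: r + t *: s) = (1 - t) * orient p q r + t * orient p q s.
Proof. by rewrite /orient !mxE; ring. Qed.

Lemma orient_rot p q r : orient q r p = orient p q r.
Proof. by rewrite /orient; ring. Qed.

Lemma orient_swap p q r : orient p r q = - orient p q r.
Proof. by rewrite /orient; ring. Qed.

Lemma orient_flip p q r : orient q p r = - orient p q r.
Proof. by rewrite /orient; ring. Qed.

Lemma orient_edge p q (t : R) : orient p q ((1 - t) *: p + t *: q) = 0.
Proof. by rewrite orient_conv /orient; ring. Qed.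

Hypothesis cw : clockwise v.

Lemma orient_inside (a b z : 'I_m) :
  (a < z)%N -> (z < b)%N -> 0 < orient (v a) (v b) (v z).
Proof. by move=> az zb; rewrite orient_swap oppr_gt0; apply: cw. Qed.

Lemma orient_outside (a b z : 'I_m) :
  (a < b)%N -> (z < a)%N || (b < z)%N -> orient (v a) (v b) (v z) < 0.
Proof.
by move=> ab /orP[za|bz]; [rewrite orient_rot|]; apply: cw.
Qed.

Lemma orient_neq0 (a b z : 'I_m) :
  a != b -> a != z -> b != z -> orient (v a) (v b) (v z) != 0.
Proof.
have key (i j k : 'I_m) : (i < j)%N -> i != k -> j != k ->
    orient (v i) (v j) (v k) != 0.
  move=> ij; rewrite -!val_eqE /= => ik jk.
  have [/andP[? ?]|out] := boolP ((i < k) && (k < j))%N.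
    by apply: lt0r_neq0; rewrite orient_inside.
  by apply: ltr0_neq0; rewrite orient_outside //; lia.
move=> ab az bz; case: (ltngtP a b) => [lt|lt|/val_inj E].
- exact: key.
- by rewrite orient_flip oppr_eq0 key.
- by rewrite E eqxx in ab.
Qed.

Lemma segmentP (a b : 'I_m) x : segment v [set a; b] x ->
  exists2 t : R, 0 <= t <= 1 & x = (1 - t) *: v a + t *: v b.
Proof.
move=> [i [j [t [E t01 ->]]]].
case/set2_eq: E => [[-> ->]|[-> ->]]; first by exists t.
by exists (1 - t); [lra|rewrite addrC opprB addrCA subrr addr0].
Qed.

Lemma segment_vertex (a b i : 'I_m) : a != b ->
  segment v [set a; b] (v i) -> i \in [set a; b].
Proof.
move=> ab /segmentP[t _ E]; rewrite !inE; apply/norP => -[ia ib].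
have := orient_neq0 ab; rewrite eq_sym in ia; rewrite eq_sym in ib.
by move=> /(_ i ia ib); rewrite E orient_edge eqxx.
Qed.

(** The two segments are the diagonals of a convex quadrilateral; Cramer's rule gives their common
    point. *)
Lemma crossing_interleaved (a b c d : 'I_m) :
  (a < c)%N -> (c < b)%N -> (b < d)%N -> crossing v [set a; b] [set c; d].
Proof.
move=> ac cb bd.
have O1 := cw ac cb; have O2 := cw (ltn_trans ac cb) bd.
have O3 := cw ac (ltn_trans cb bd); have O4 := cw cb bd.
(* [D] is twice the signed area of the quadrilateral a c b d, cut here along c d and in [DE] along a
   b. It is the determinant of the system for the meeting point, at parameter [s] on a b and [t] on
   c d. *)
set D := orient (v a) (v c) (v d) + orient (v c) (v b) (v d).
have D0 : D < 0 by rewrite /D; lra.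
have DE : D = orient (v a) (v c) (v b) + orient (v a) (v b) (v d).
  by rewrite /D /orient; ring.
pose s := orient (v a) (v c) (v d) / D.
pose t := orient (v a) (v c) (v b) / D.
have bnd (y z : R) : y < 0 -> z < 0 -> 0 <= y / (y + z) <= 1.
  move=> y0 z0; have yz : y + z < 0 by lra.
  by rewrite ler_ndivlMr // ler_ndivrMr // !(mul0r, mul1r); apply/andP; split; lra.
have Dn0 : D != 0 by apply: ltr0_neq0.
exists ((1 - s) *: v a + s *: v b); split.
- by exists a, b, s; split=> //; apply: bnd.
- exists c, d, t; split=> //; first by rewrite /t DE; apply: bnd.
  have H (x1 y1 x2 y2 : 'rV[R]_2) k : D * ((1 - s) * x1 0 k + s * x2 0 k) =
      D * ((1 - t) * y1 0 k + t * y2 0 k) ->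
      ((1 - s) *: x1 + s *: x2) 0 k = ((1 - t) *: y1 + t *: y2) 0 k.
    by rewrite !mxE => /(mulfI Dn0).
  have Ds : D * s = orient (v a) (v c) (v d) by rewrite /s mulrC divfK.
  have Dt : D * t = orient (v a) (v c) (v b) by rewrite /t mulrC divfK.
  have e1 (x y u : R) : D * ((1 - u) * x + u * y) = (D - D * u) * x + D * u * y.
    by ring.
  by apply: rV2P; apply: H; rewrite !e1 Ds Dt /D /orient; ring.
- move=> [i]; rewrite !inE => /andP[/orP[] /eqP-> /orP[] /eqP E _];
  move: ac cb bd; rewrite ?E -?E; lia.
Qed.

(** Along a c the orientation against a b is [t] times a nonzero number, so a common point has
    [t = 0] and is the shared endpoint. *)
Lemma crossing_sharedF (a b c : 'I_m) :
  a != b -> a != c -> b != c -> ~ crossing v [set a; b] [set a; c].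
Proof.
move=> ab ac bc [x [/segmentP[s _ Es] /segmentP[t _ Et] nx]]; apply: nx.
exists a; first by rewrite !inE eqxx.
have := orient_edge (v a) (v b) s; rewrite -Es Et orient_conv => E.
have t0 : t = 0.
  have z : orient (v a) (v b) (v a) = 0 by rewrite /orient; ring.
  move/eqP: E; rewrite z mulr0 add0r mulf_eq0 => /orP[/eqP //|].
  by rewrite (negbTE (orient_neq0 ab ac bc)).
by rewrite t0 subr0 scale1r scale0r addr0.
Qed.

(** Both c and d lie strictly on one side of the line a b, and so does every point between them. *)
Lemma crossing_parallelF (a b c d : 'I_m) : (a < b)%N ->
  a != c -> a != d -> b != c -> b != d ->
  ((a < c) && (c < b) = (a < d) && (d < b))%N ->
  ~ crossing v [set a; b] [set c; d].
Proof.
move=> ab ac ad bc bd side [x [/segmentP[s _ Es] /segmentP[t t01 Et] _]].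
have := orient_edge (v a) (v b) s; rewrite -Es Et orient_conv => E.
move: ac ad bc bd; rewrite -!val_eqE /= => ac ad bc bd.
have [/andP[ai ib]|out] := boolP ((a < c) && (c < b))%N.
  have /andP[aj jb] : ((a < d) && (d < b))%N by rewrite -side ai ib.
  by have := orient_inside ai ib; have := orient_inside aj jb; nra.
have oc : orient (v a) (v b) (v c) < 0 by apply: orient_outside => //; lia.
have od : orient (v a) (v b) (v d) < 0 by apply: orient_outside => //; lia.
by move: oc od; nra.
Qed.

(** This trades geometry for the order of labels: two edges that do not interleave share an endpoint
    or have c and d on the same side of a b. *)
Lemma crossingE (a b c d : 'I_m) : (a < b)%N -> (c < d)%N ->
  [set a; b] != [set c; d] ->
  crossing v [set a; b] [set c; d] <->
  ([&& a < c, c < b & b < d] || [&& c < a, a < d & d < b])%N.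
Proof.
move=> ab cd ne; split; last first.
  case/orP=> /and3P[h1 h2 h3]; first exact: crossing_interleaved.
  have [x [s1 s2 s3]] := crossing_interleaved h1 h2 h3.
  by exists x; split=> //; rewrite finset.setIC.
move=> cr; apply/negPn/negP => ni.
have ab' : a != b by rewrite -val_eqE /=; lia.
have cd' : c != d by rewrite -val_eqE /=; lia.
have [ac|ac] := eqVneq a c.
  subst c; apply: crossing_sharedF cr => //.
  by apply: contraNneq ne => ->.
have [ad|ad] := eqVneq a d.
  subst d; move: cr; rewrite [[set c; a]]finset.setUC; apply: crossing_sharedF => //.
  by apply: contraNneq ne => ->; rewrite finset.setUC.
have [bc|bc] := eqVneq b c.
  subst c; move: cr; rewrite [[set a; b]]finset.setUC; apply: crossing_sharedF => //.
  by rewrite eq_sym.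
have [bd|bd] := eqVneq b d.
  subst d; move: cr; rewrite [[set a; b]]finset.setUC [[set c; b]]finset.setUC.
  by apply: crossing_sharedF => //; rewrite eq_sym.
apply: crossing_parallelF cr => //.
by move: ac ad bc bd; rewrite -!val_eqE /=; lia.
Qed.

End Crossing.

(** * Graphs as relations between labels *)

Definition interleaved (a b c d : nat) : bool :=
  [&& a < c, c < b & b < d] || [&& c < a, a < d & d < b].

Definition noncrossing_rel (e : rel nat) : Prop :=
  forall a b c d, a < c -> c < b -> b < d -> e a b -> e c d -> False.

Definition maximal_rel (m : nat) (e : rel nat) : Prop :=
  forall a b, a < b -> b < m ->
    (forall c d, c < d -> e c d -> ~~ interleaved a b c d) -> e a b.

Section Adjacency.
Variable m : nat.
Implicit Types (G : {set {set 'I_m}}) (s : seq ('I_m * 'I_m)).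

Definition adj G (a b : nat) : bool :=
  [exists i : 'I_m, exists j : 'I_m,
    [&& i == a :> nat, j == b :> nat & [set i; j] \in G]].

Lemma adjP G a b : reflect
  (exists i j : 'I_m, [/\ i = a :> nat, j = b :> nat & [set i; j] \in G])
  (adj G a b).
Proof.
apply: (iffP existsP) => [[i /existsP[j /and3P[/eqP<- /eqP<- ?]]]|].
  by exists i, j.
by move=> [i [j [<- <- ?]]]; exists i; apply/existsP; exists j; rewrite !eqxx.
Qed.

Lemma adj_ord G (i j : 'I_m) : adj G i j = ([set i; j] \in G).
Proof.
apply/adjP/idP => [[k [l [/val_inj-> /val_inj->]]] //|?].
by exists i, j.
Qed.

Lemma adjC G a b : adj G a b = adj G b a.
Proof.
by apply/adjP/adjP => -[i [j [? ? ?]]]; exists j, i; rewrite finset.setUC.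
Qed.

Lemma adj_lt G a b : adj G a b -> a < m /\ b < m.
Proof. by move/adjP => [i [j [<- <- _]]]; split. Qed.

Lemma segments_edge G e : segments G -> e \in G ->
  exists a b : 'I_m, a < b /\ e = [set a; b].
Proof.
move=> sG eG; have /eqP/cards2P[a [b [ab ->]]] := sG _ eG.
case: (ltngtP a b) => [?|?|/val_inj ?]; first by exists a, b.
  by exists b, a; rewrite finset.setUC.
by subst b; rewrite eqxx in ab.
Qed.

Lemma adj_neq G a b : segments G -> adj G a b -> a != b.
Proof.
move=> sG /adjP[i [j [<- <- /sG]]]; rewrite cards2; apply: contra_eq_neq.
by move=> /val_inj->; rewrite eqxx.
Qed.

Lemma sub_adj G G' : segments G ->
  (forall a b, a < b -> adj G a b -> adj G' a b) -> G \subset G'.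
Proof.
move=> sG H; apply/fintype.subsetP => e eG.
have [a [b [ab E]]] := segments_edge sG eG.
by rewrite E -adj_ord; apply: H => //; rewrite adj_ord -E.
Qed.

(** The relation is read on increasing pairs only, the form in which words produce their edges. *)
Definition graph_of (e : rel nat) : {set {set 'I_m}} :=
  [set [set p.1; p.2] | p : 'I_m * 'I_m & (p.1 < p.2) && e p.1 p.2].

Lemma segments_graph_of e : segments (graph_of e).
Proof.
move=> f /imsetP[[i j]]; rewrite inE /= => /andP[ij _] ->.
by rewrite cards2 -val_eqE /= neq_ltn ij.
Qed.

Lemma adj_graph_of e a b : a < b -> adj (graph_of e) a b = (b < m) && e a b.
Proof.
move=> ab; apply/idP/andP => [ad|[bm eab]].
  have [am bm] := adj_lt ad; split=> //.
  move: ad; rewrite -[a]/(val (Ordinal am)) -[b]/(val (Ordinal bm)) adj_ord.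
  move=> /imsetP[[k l]]; rewrite inE /= => /andP[kl ekl] /set2_eq[] [].
    by move=> /(congr1 val) /= -> /(congr1 val) /= ->.
  by move=> /(congr1 val) /= ? /(congr1 val) /= ?; lia.
have am := ltn_trans ab bm.
apply/adjP; exists (Ordinal am), (Ordinal bm); split=> //.
by apply/imsetP; exists (Ordinal am, Ordinal bm); rewrite ?inE /= ?ab.
Qed.

Lemma lists_adj s G a b : lists s G -> a != b ->
  adj G a b = ((a, b) \in [seq (val p.1, val p.2) | p <- s]) ||
              ((b, a) \in [seq (val p.1, val p.2) | p <- s]).
Proof.
move=> /perm_mem sG ab; apply/adjP/orP => [[i [j [<- <-]]]|].
  rewrite -mem_enum -sG => /mapP[[k l] kl] /= /set2_eq[] [-> ->].
    by left; apply/mapP; exists (k, l).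
  by right; apply/mapP; exists (k, l).
move=> [] /mapP[[k l] kl] [-> ->]; [exists k, l|exists l, k]; split=> //.
  by rewrite -mem_enum -sG; apply/mapP; exists (k, l).
by rewrite finset.setUC -mem_enum -sG; apply/mapP; exists (k, l).
Qed.

(** Turns the pairs of numbers produced by a word into a listing of a graph, as the specification of
    the output demands. *)
Lemma lists_exists (l : seq (nat * nat)) G : segments G -> uniq l ->
  (forall p, p \in l -> p.1 < p.2) ->
  (forall a b, a < b -> ((a, b) \in l) = adj G a b) ->
  exists s, l = [seq (val p.1, val p.2) | p <- s] /\ lists s G.
Proof.
move=> sG ul lt_l lG.
have [s Es] : exists s : seq ('I_m * 'I_m), l = [seq (val p.1, val p.2) | p <- s].
  have : forall p, p \in l -> p.1 < m /\ p.2 < m.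
    by move=> [a b] abl; apply: (@adj_lt G); rewrite -lG //; apply: (lt_l _ abl).
  elim: (l) => [|[a b] l' IH] H; first by exists [::].
  have [|s ->] := IH; first by move=> p pl; apply: H; rewrite inE pl orbT.
  have [am bm] := H (a, b) (mem_head _ _).
  by exists ((Ordinal am, Ordinal bm) :: s).
exists s; split=> //; apply: uniq_perm; last 1 first.
- move=> e; rewrite mem_enum; apply/mapP/idP.
    move=> [[i j] ijs ->] /=; rewrite -adj_ord.
    have ijl : (val i, val j) \in l by rewrite Es; apply/mapP; exists (i, j).
    by rewrite -lG //; apply: (lt_l _ ijl).
  move=> eG; have [a [b [ab Ee]]] := segments_edge sG eG.
  move: eG; rewrite Ee -adj_ord -lG // Es => /mapP[[i j] ijs [/val_inj-> /val_inj->]].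
  by exists (i, j).
(* Two distinct pairs with the same underlying set would be reversals of each other, which
   increasing pairs cannot be. *)
- rewrite map_inj_in_uniq; first by move: ul; rewrite Es => /map_uniq.
  move=> [i j] [k h] /= ij kh /set2_eq[[-> ->]//|[ih jk]]; subst h k.
  have := lt_l (val i, val j); have := lt_l (val j, val i).
  rewrite Es => /(_ (map_f _ kh)) /= ? /(_ (map_f _ ij)) /= ?; lia.
- exact: enum_uniq.
Qed.

(** The smaller endpoint depends only on the edge as a set, through the predicate [P], so the count
    ignores the order of edges and of endpoints. *)
Lemma lists_count s s' G i : lists s G -> lists s' G ->
  count (fun p => minn (val p.1) (val p.2) == i) s =
  count (fun p => minn (val p.1) (val p.2) == i) s'.
Proof.
move=> sG s'G.
pose P (e : {set 'I_m}) := [exists x in e, (x == i :> nat) && [forall y in e, i <= y]].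
have PE (t : seq ('I_m * 'I_m)) :
    count (fun p => minn (val p.1) (val p.2) == i) t = count P [seq [set p.1; p.2] | p <- t].
  rewrite count_map; apply: eq_count => -[x y] /=; apply/idP/existsP.
    move=> /= E; have [xy|yx] := leqP (x : nat) y.
      exists x; rewrite set21 /=; apply/andP; split; first by lia.
      apply/forallP => z; rewrite !inE; apply/implyP => /orP[] /eqP->; lia.
    exists y; rewrite set22 /=; apply/andP; split; first by lia.
    apply/forallP => z; rewrite !inE; apply/implyP => /orP[] /eqP->; lia.
  move=> [z /and3P[zxy /eqP zi /forallP H]].
  have := H x; have := H y; rewrite set21 set22 /= => {H}.
  by move: zxy; rewrite !inE => /orP[] /eqP Ez; subst z; lia.
rewrite !PE; apply/seq.permP; apply: perm_trans sG _.
by rewrite perm_sym.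
Qed.

End Adjacency.

(** * Plane graphs and triangulations in terms of labels *)

Section PlaneGraphs.
Variables (R : realType) (m : nat) (v : 'I_m -> 'rV[R]_2).
Hypothesis cw : clockwise v.
Implicit Types (G : {set {set 'I_m}}).

Lemma noncrossingP G : segments G -> noncrossing v G <-> noncrossing_rel (adj G).
Proof.
move=> sG; split.
  move=> nc a b c d ac cb bd /adjP[i [j [Ei Ej ij]]] /adjP[k [l [Ek El kl]]].
  subst a b c d.
  have ne : [set i; j] != [set k; l].
    by apply/eqP => /set2_eq[] [] /(congr1 val) /= ? /(congr1 val) /= ?; lia.
  by apply: (nc _ _ ij kl ne); apply: crossing_interleaved.
move=> nc e e' eG e'G.
have [a [b [ab Ee]]] := segments_edge sG eG.
have [c [d [cd Ee']]] := segments_edge sG e'G; subst e e' => ne.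
rewrite -!adj_ord in eG e'G.
by move=> /(crossingE cw ab cd ne) /orP[] /and3P[? ? ?];
  [apply: (nc a b c d)|apply: (nc c d a b)].
Qed.

Lemma plane_graphP G : segments G -> plane_graph v G <-> noncrossing_rel (adj G).
Proof.
move=> sG; split=> [[_ /(noncrossingP sG)//]|nc].
split=> //; first exact/noncrossingP.
move=> e i eG; have [a [b [ab ->]]] := segments_edge sG eG.
by apply: segment_vertex => //; rewrite -val_eqE /= neq_ltn ab.
Qed.

(** Maximality is tested one edge at a time. Forwards, an edge that crosses nothing can be added to
    [G], so it was there already. Backwards, an edge of a larger plane graph crosses no edge of [G],
    so it belongs to [G]. *)
Lemma triangulationP G : segments G ->
  triangulation v G <-> noncrossing_rel (adj G) /\ maximal_rel m (adj G).
Proof.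
move=> sG; split=> [[/(plane_graphP sG) nc max]|[nc max]].
  split=> // a b ab bm free; have am := ltn_trans ab bm.
  pose e := [set Ordinal am; Ordinal bm].
  have sG' : segments (e |: G).
    move=> f /setU1P[->|/sG //]; rewrite cards2 -val_eqE /= neq_ltn ab //.
  have adjG' x y : x < y -> adj (e |: G) x y -> (x, y) = (a, b) \/ adj G x y.
    move=> xy /adjP[i [j [Ei Ej]]]; rewrite -Ei -Ej => /setU1P[|].
      move=> /set2_eq[] [] /(congr1 val) /= E1 /(congr1 val) /= E2; last by lia.
      by rewrite E1 E2; left.
    by right; rewrite adj_ord.
  have ->: adj G a b = adj (e |: G) a b.
    rewrite (max (e |: G)) //; last exact: finset.subsetUr.
    apply/plane_graphP => // x y z t xz zy yt.
    move=> /(adjG' _ _ (ltn_trans xz zy)) exy /(adjG' _ _ (ltn_trans zy yt)) ezt.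
    case: exy ezt => [[? ?]|exy] [[? ?]|ezt]; subst.
    - by lia.
    - by have := free _ _ (ltn_trans zy yt) ezt; rewrite /interleaved; lia.
    - by have := free _ _ (ltn_trans xz zy) exy; rewrite /interleaved; lia.
    - exact: nc exy ezt.
  by apply/adjP; exists (Ordinal am), (Ordinal bm); rewrite setU11.
split; first exact/plane_graphP.
move=> G' [sG' /(noncrossingP sG') nc' _] GG'; apply/eqP; rewrite finset.eqEsubset GG' andbT.
have sub a b : adj G a b -> adj G' a b.
  by move=> /adjP[i [j [<- <- /(fintype.subsetP GG') ?]]]; rewrite adj_ord.
apply: sub_adj => // a b ab ab'; apply: max => //; first by case: (adj_lt ab').
move=> c d cd /sub cd'; apply/negP => /orP[] /and3P[? ? ?].
  exact: nc' ab' cd'.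
exact: nc' cd' ab'.
Qed.

End PlaneGraphs.

(** * Dyck words and matchings *)

Section Words.
Implicit Types (w : nat -> bool) (n u v : nat).

(* A word has letters w 0, w 1, ...; true is an opening letter. *)
Fixpoint ups w v : nat := if v is u.+1 then ups w u + w u else 0.

(** The first condition says that every prefix has at least as many opening as closing letters. *)
Definition dyck n w : Prop :=
  (forall v, v <= 2 * n -> v <= (ups w v).*2) /\ ups w (2 * n) = n.

(** The positions of the unmatched opening letters, the latest first. *)
Fixpoint stack w v : seq nat :=
  if v is u.+1 then
    if w u then u :: stack w u else behead (stack w u)
  else [::].

Fixpoint pairs w v : seq (nat * nat) :=
  if v is u.+1 then
    if w u then pairs w u else rcons (pairs w u) (head 0 (stack w u), u)
  else [::].

Fixpoint chain n w v : seq nat :=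
  if v is u.+1 then
    let c := chain n w u in
    if w u then (head 0 c).-1 :: c else head 0 c :: drop 2 c
  else [:: n; n.+1].

Definition chain_edge n w v : nat * nat :=
  (nth 0 (chain n w v) 0, nth 0 (chain n w v) 1).

Definition chain_edges n w v : seq (nat * nat) := mkseq (chain_edge n w) v.+1.

Lemma ups_mono w u v : u <= v -> ups w u <= ups w v.
Proof.
by move=> /subnK <-; elim: (v - u) => //= k /leq_trans-> //; apply: leq_addr.
Qed.

Lemma dyck_ups_le n w v : dyck n w -> v <= 2 * n -> ups w v <= n.
Proof. by move=> [_ {2}<-]; apply: ups_mono. Qed.

(** The prefix condition keeps [behead] from being applied to the empty stack, where the count would
    fail. *)
Lemma size_stack N w v : (forall u, u <= N -> u <= (ups w u).*2) ->
  v <= N -> size (stack w v) + v = (ups w v).*2.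
Proof.
move=> H; elim: v => //= v IH lt_v; have := IH (ltnW lt_v); have := H _ lt_v => /=.
by case: (w v) => /=; rewrite ?size_behead; lia.
Qed.

Lemma size_pairs w v : size (pairs w v) + ups w v = v.
Proof. by elim: v => //= v; case: (w v); rewrite ?size_rcons; lia. Qed.

Lemma eq_ups w w' v : (forall u, u < v -> w u = w' u) -> ups w v = ups w' v.
Proof. by elim: v => //= v IH H; rewrite IH ?H // => u uv; apply/H/ltnW. Qed.

Lemma eq_chain n w w' v :
  (forall u, u < v -> w u = w' u) -> chain n w v = chain n w' v.
Proof. by elim: v => //= v IH H; rewrite IH ?H // => u uv; apply/H/ltnW. Qed.

Lemma eq_stack w w' v : (forall u, u < v -> w u = w' u) -> stack w v = stack w' v.
Proof. by elim: v => //= v IH H; rewrite IH ?H // => u uv; apply/H/ltnW. Qed.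

Lemma eq_pairs w w' v : (forall u, u < v -> w u = w' u) -> pairs w v = pairs w' v.
Proof.
elim: v => //= v IH H; rewrite IH ?H // => [|u uv]; last exact/H/ltnW.
by rewrite (@eq_stack w w') // => u uv; apply/H/ltnW.
Qed.

End Words.

(** * The bracket structure of a Dyck word *)

Section PairsOfWord.
Implicit Types (w : nat -> bool).

(** The invariant of the stack run. By [pm_visible] no open position lies under a finished pair;
    this is why closing the top of the stack creates no crossing. *)
Record partial_matching (w : nat -> bool) (v : nat) (s : seq nat)
    (P : seq (nat * nat)) : Prop := PartialMatching {
  pm_sorted : sorted gtn s;
  pm_stack : forall x, x \in s -> x < v /\ w x;
  pm_pair : forall a b, (a, b) \in P -> [/\ a < b, b < v, w a & ~~ w b];
  pm_total : forall x, x < v ->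
    x \in s \/ exists y, (x, y) \in P \/ (y, x) \in P;
  pm_left : forall a b b', (a, b) \in P -> (a, b') \in P -> b = b';
  pm_right : forall a a' b, (a, b) \in P -> (a', b) \in P -> a = a';
  pm_free : forall a b, (a, b) \in P -> a \notin s;
  pm_noncrossing : noncrossing_rel (fun a b => (a, b) \in P);
  pm_visible : forall a b x, (a, b) \in P -> x \in s -> ~~ (a < x < b);
  pm_uniq : uniq P
}.

Lemma partial_matching_push w v s P : w v ->
  partial_matching w v s P -> partial_matching w v.+1 (v :: s) P.
Proof.
move=> wv [srt stk pr tot lf rt fr nc vis un]; split=> //.
- rewrite /= (path_sortedE (rev_trans ltn_trans)) srt andbT.
  by apply/allP => x /stk[].
- by move=> x; rewrite inE => /orP[/eqP->//|/stk[? ?]]; split=> //; lia.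
- by move=> a b /pr[? ? ? ?]; split=> //; lia.
- move=> x; rewrite ltnS leq_eqVlt inE => /orP[->|/tot[->|]]; first by left.
    by left; rewrite orbT.
  by right.
- move=> a b ab; rewrite inE negb_or (fr _ _ ab) andbT.
  by case: (pr _ _ ab); lia.
- move=> a b x ab; rewrite inE => /orP[/eqP->|/(vis _ _ _ ab)//].
  by case: (pr _ _ ab); lia.
Qed.

Lemma partial_matching_pop w v u s P : ~~ w v ->
  partial_matching w v (u :: s) P ->
  partial_matching w v.+1 s (rcons P (u, v)).
Proof.
move=> wv [srt stk pr tot lf rt fr nc vis un].
have [uv wu] := stk u (mem_head _ _).
have su x : x \in s -> x < u.
  by move: srt; rewrite /= (path_sortedE (rev_trans ltn_trans)) => /andP[/allP H _] /H.
have uP b : (u, b) \notin P.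
  by apply/negP => /fr; rewrite mem_head.
have vP a : (a, v) \notin P.
  by apply/negP => /pr[_]; rewrite ltnn.
split=> //.
- exact: path_sorted srt.
- move=> x xs; have [|? ?] := stk x; first by rewrite inE xs orbT.
  by split=> //; lia.
- move=> a b; rewrite mem_rcons inE => /orP[/eqP[-> ->]|/pr[? ? ? ?]]; split=> //; lia.
- move=> x; rewrite ltnS leq_eqVlt => /orP[/eqP->|/tot[]].
  + by right; exists u; right; rewrite mem_rcons mem_head.
  + rewrite inE => /orP[/eqP->|]; last by left.
    by right; exists v; left; rewrite mem_rcons mem_head.
  + by move=> [y [] xy]; right; exists y; [left|right]; rewrite mem_rcons inE xy orbT.
- move=> a b b'; rewrite !mem_rcons !inE.
  move=> /orP[/eqP[E1 E2]|ab] /orP[/eqP[E3 E4]|ab']; subst => //.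
  + by rewrite (negbTE (uP _)) in ab'.
  + by rewrite (negbTE (uP _)) in ab.
  + exact: lf ab ab'.
- move=> a b b'; rewrite !mem_rcons !inE.
  move=> /orP[/eqP[E1 E2]|ab] /orP[/eqP[E3 E4]|ab']; subst => //.
  + by rewrite (negbTE (vP _)) in ab'.
  + by rewrite (negbTE (vP _)) in ab.
  + exact: rt ab ab'.
- move=> a b; rewrite mem_rcons inE => /orP[/eqP[-> _]|/fr].
    by apply/negP => /su; rewrite ltnn.
  by rewrite inE negb_or => /andP[].
- move=> a b c d ac cb bd; rewrite !mem_rcons !inE.
  move=> /orP[/eqP[E1 E2]|ab] /orP[/eqP[E3 E4]|cd]; subst.
  + by lia.
  + by case: (pr _ _ cd); lia.
  + by have := vis _ _ _ ab (mem_head _ _); lia.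
  + exact: nc ac cb bd ab cd.
- move=> a b x; rewrite mem_rcons inE => /orP[/eqP[-> ->] /su|ab xs]; first by lia.
  by apply: vis ab _; rewrite inE xs orbT.
- by rewrite rcons_uniq uP.
Qed.

Lemma dyck_matching n w v : dyck n w -> v <= 2 * n ->
  partial_matching w v (stack w v) (pairs w v).
Proof.
move=> dw; elim: v => [_|v IH lt_v]; first by split.
have {}IH := IH (ltnW lt_v); rewrite /=.
case: ifPn => wv; first exact: partial_matching_push.
have := size_stack dw.1 (ltnW lt_v); have := dw.1 _ lt_v; rewrite /= (negbTE wv).
case E: (stack w v) IH => [|u s] IH /=; first by lia.
by move=> _ _; apply: partial_matching_pop.
Qed.

Lemma dyck_stack_end n w : dyck n w -> stack w (2 * n) = [::].
Proof.
move=> dw; apply: size0nil; have := size_stack dw.1 (leqnn _); rewrite dw.2; lia.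
Qed.

End PairsOfWord.

Definition matching_rel (N : nat) (e : rel nat) : Prop :=
  [/\ (forall a b, e a b = e b a), (forall a b, e a b -> a != b /\ a < N),
      (forall a, a < N -> exists b, e a b) &
      (forall a b b', e a b -> e a b' -> b = b')].

(** * The Dyck word of a noncrossing matching *)

Section WordOfMatching.
Variables (n : nat) (e : rel nat) (w : nat -> bool).
Hypothesis em : matching_rel (2 * n) e.
Hypothesis nc : noncrossing_rel e.
Hypothesis wE : forall v, v < 2 * n -> reflect (exists2 b, v < b & e v b) (w v).

(** The stack consists of the points before [v] whose partner is not yet passed, so the bracket
    structure of the word rebuilds [e]. *)
Lemma word_of_matching_run v : v <= 2 * n ->
  [/\ size (stack w v) + v = (ups w v).*2, sorted gtn (stack w v),
      (forall x, x \in stack w v <-> x < v /\ exists2 y, v <= y & e x y) &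
      (forall a b, a < b -> ((a, b) \in pairs w v) = (b < v) && e a b)].
Proof.
have [eC eN eT eF] := em.
elim: v => [_|v IH lt_v]; first by split=> // x; split=> // -[].
have {IH}[Hsz Hs Hst Hp] := IH (ltnW lt_v); rewrite /=.
case: (wE lt_v) => [[b vb evb]|nw].
  have ev x : e x v -> x = b by rewrite eC => /eF/(_ evb).
  split=> [||x|x y xy].
  - by rewrite /=; lia.
  - rewrite /= (path_sortedE (rev_trans ltn_trans)) Hs andbT.
    by apply/allP => x /Hst[].
  - rewrite inE; split.
      case/orP=> [/eqP->|/Hst[xv [y vy exy]]]; first by split=> //; exists b.
      split; first by lia.
      exists y => //; rewrite ltn_neqAle vy andbT.
      by apply/eqP => E; subst y; have := ev _ exy; lia.
    move=> [xv [y vy exy]]; have [//|ne /=] := eqVneq x v.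
    by apply/Hst; split; [lia|exists y => //; lia].
  - rewrite Hp //; have [E|ne] := eqVneq y v; last by congr (_ && _); lia.
    subst y; rewrite ltnn leqnn /=; symmetry; apply/negbTE/negP => /ev; lia.
have [u uv] := eT _ lt_v.
have ltuv : u < v.
  have [ne _] := eN _ _ uv; rewrite ltn_neqAle eq_sym ne leqNgt.
  by apply/negP => vu; apply: nw; exists u.
have euv : e u v by rewrite eC.
have us : u \in stack w v by apply/Hst; split=> //; exists v.
case E: (stack w v) Hsz Hs Hst us => [//|x s] Hsz Hs Hst us /=.
have sx y : y \in s -> y < x.
  by move: Hs; rewrite /= (path_sortedE (rev_trans ltn_trans)) => /andP[/allP H _] /H.
(* Otherwise the partner [u] of [v] lies below the top [x], whose own partner [y] comes after [v],
   and the edges u v and x y cross. *)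
have Ex : x = u.
  move: us; rewrite inE => /orP[/eqP//|us]; exfalso.
  have [xv [y vy exy]] := (Hst x).1 (mem_head _ _).
  apply: (@nc u v x y) => //; first exact: sx.
  rewrite ltn_neqAle vy andbT; apply/eqP => Ey; subst y.
  by rewrite eC in exy; have := eF _ _ _ uv exy; have := sx _ us; lia.
subst x; split=> [||y|y z yz].
- by move: Hsz => /=; lia.
- exact: path_sorted Hs.
- split.
    move=> ys; have [|yv [z vz eyz]] := (Hst y).1; first by rewrite inE ys orbT.
    split; first by lia.
    exists z => //; rewrite ltn_neqAle vz andbT; apply/eqP => Ez; subst z.
    by rewrite eC in eyz; have := eF _ _ _ uv eyz; have := sx _ ys; lia.
  move=> [yv [z vz eyz]].
  have yv' : y != v by apply/eqP => Ey; subst y; have := eF _ _ _ uv eyz; lia.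
  have : y \in u :: s by apply/Hst; split; [lia|exists z => //; lia].
  rewrite inE => /orP[/eqP Ey|//]; subst y.
  by have := eF _ _ _ euv eyz; lia.
- rewrite mem_rcons inE Hp //; have [Ez|ne] := eqVneq z v.
    subst z; rewrite ltnn leqnn /= orbF xpair_eqE eqxx andbT.
    apply/eqP/idP => [->//|]; rewrite eC => eyv; exact: eF eyv uv.
  by rewrite xpair_eqE (negbTE ne) andbF /=; congr (_ && _); lia.
Qed.

Lemma dyck_word_of_matching : dyck n w.
Proof.
split=> [v /word_of_matching_run[<- _ _ _]|]; first exact: leq_addl.
have [Hsz _ Hst _] := word_of_matching_run (leqnn _).
have [eC eN _ _] := em.
case E: (stack w _) Hst Hsz => [|x s] Hst /=; first by lia.
have [_ [y ny exy]] := (Hst x).1 (mem_head _ _).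
by rewrite eC in exy; have [_] := eN _ _ exy; lia.
Qed.

Lemma mem_pairs_word_of_matching a b : a < b ->
  ((a, b) \in pairs w (2 * n)) = e a b.
Proof.
move=> ab; have [_ _ _ ->//] := word_of_matching_run (leqnn _).
have [eC eN _ _] := em.
by rewrite andbC; case H: (e a b) => //=; rewrite eC in H; case: (eN _ _ H).
Qed.

End WordOfMatching.

(** * Dyck words and triangulations *)

(* The edges E triangulate the polygon whose upper boundary is the chain c. *)
Record triangulated (n : nat) (c : seq nat) (E : seq (nat * nat)) : Prop :=
  Triangulated {
  tr_path : sorted (fun x y => (x < y) && ((x, y) \in E)) c;
  tr_top : forall x : nat, x \in c -> x <= n.+1;
  tr_edge : forall a b, (a, b) \in E -> [/\ head 0 c <= a, a < b & b <= n.+1];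
  tr_noncrossing : noncrossing_rel (fun a b => (a, b) \in E);
  tr_visible : forall a b x : nat, (a, b) \in E -> x \in c -> ~~ (a < x < b);
  tr_covered : forall x, head 0 c <= x <= n.+1 -> x \notin c ->
    exists a b, (a, b) \in E /\ a < x < b;
  tr_maximal : forall a b, head 0 c <= a -> a < b -> b <= n.+1 ->
    [\/ (a, b) \in E, exists p q, (p, q) \in E /\ interleaved a b p q
      | a \in c /\ b \in c];
  tr_uniq : uniq E
}.

Lemma sorted_lt_edge (E : rel nat) x c :
  path (fun y z => (y < z) && E y z) x c -> forall y : nat, y \in c -> x < y.
Proof.
move=> p; have {}p : path ltn x c by apply: sub_path p => y z /andP[].
by move: p; rewrite (path_sortedE ltn_trans) => /andP[/allP H _] y /H.
Qed.

Lemma triangulated_base n : triangulated n [:: n; n.+1] [:: (n, n.+1)].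
Proof.
split=> //.
- by rewrite /= mem_head ltnSn.
- by move=> x; rewrite !inE => /orP[] /eqP->.
- by move=> a b; rewrite inE => /eqP[-> ->] /=.
- by move=> a b c d ? ? ?; rewrite !inE => /eqP[? ?] /eqP[? ?]; lia.
- by move=> a b x; rewrite !inE => /eqP[-> ->]; lia.
- by move=> x /=; rewrite !inE; lia.
- by move=> a b /= ? ? ?; constructor 1; rewrite inE xpair_eqE; lia.
Qed.

(** Only the candidate edges at the new vertex [x] need thought: their other end is on the chain or
    covered. *)
Lemma triangulated_push n x c E : triangulated n (x.+1 :: c) E ->
  triangulated n [:: x, x.+1 & c] (rcons E (x, x.+1)).
Proof.
case=> pth top edg nc vis cov mx un; rewrite /= in edg cov mx.
have lt_c := sorted_lt_edge pth.
have xE b : (x, b) \notin E by apply/negP => /edg[]; rewrite ltnn.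
split=> //=.
- rewrite mem_rcons mem_head ltnSn /=; apply: sub_path pth => y z /andP[-> yz].
  by rewrite mem_rcons inE yz orbT.
- by move=> y; rewrite inE => /orP[/eqP->|/top//]; have := top _ (mem_head _ _); lia.
- move=> a b; rewrite mem_rcons inE => /orP[/eqP[-> ->]|/edg[? ? ?]]; last by split=> //; lia.
  by split=> //; have := top _ (mem_head _ _); lia.
- move=> a b p q ap pb bq; rewrite !mem_rcons !inE.
  move=> /orP[/eqP[E1 E2]|ab] /orP[/eqP[E3 E4]|cd]; subst; try lia.
  exact: nc ab cd.
- move=> a b y; rewrite mem_rcons !inE => /orP[/eqP[-> ->]|ab]; first by lia.
  case/or3P => [/eqP->|/eqP->|yc]; last by apply: vis ab _; rewrite inE yc orbT.
    by case: (edg _ _ ab); lia.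
  by case: (edg _ _ ab); lia.
- move=> y yx; rewrite inE negb_or => /andP[ne yc].
  have [|a [b [ab ayb]]] := cov y _ yc; first by lia.
  by exists a, b; rewrite mem_rcons inE ab orbT.
- move=> a b xa ab bn; have [Ea|ne] := eqVneq a x; last first.
    have xa' : x < a by lia.
    case: (mx a b xa' ab bn) => [h|[p [q [pq H]]]|[ac bc]].
    + by constructor 1; rewrite mem_rcons inE h orbT.
    + by constructor 2; exists p, q; rewrite mem_rcons inE pq orbT.
    + by constructor 3; rewrite 2![_ \in x :: _]inE ac bc !orbT.
  subst a; have [bc|bc] := boolP (b \in x.+1 :: c).
    by constructor 3; rewrite mem_head [_ \in _]inE bc orbT.
  (* A vertex [b] off the chain lies strictly under an edge p q; since p q starts after [x], the
     edge x b crosses it. *)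
  have [|p [q [pq H]]] := cov b _ bc; first by lia.
  constructor 2; exists p, q; rewrite mem_rcons inE pq orbT; split=> //.
  by rewrite /interleaved; case: (edg _ _ pq); lia.
- by rewrite rcons_uniq xE.
Qed.

(** The triangle x y z is added and [y] becomes covered by x z. No old edge crosses x z, because [z]
    is visible and no edge starts before [x]. *)
Lemma triangulated_pop n x y z c E : triangulated n [:: x, y, z & c] E ->
  triangulated n [:: x, z & c] (rcons E (x, z)).
Proof.
case=> pth top edg nc vis cov mx un; rewrite /= in edg cov mx.
have /and3P[/andP[xy Exy] /andP[yz Eyz] pz] := pth.
have lt_c := sorted_lt_edge pz.
have sub u : u \in [:: x, z & c] -> u \in [:: x, y, z & c].
  by rewrite !inE => /or3P[]->; rewrite ?orbT.
split=> //=.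
- rewrite mem_rcons mem_head (ltn_trans xy yz) /=; apply: sub_path pz => s t /andP[-> st].
  by rewrite mem_rcons inE st orbT.
- by move=> u /sub/top.
- move=> a b; rewrite mem_rcons inE => /orP[/eqP[-> ->]|/edg//].
  by split=> //; [lia|apply: top; rewrite !inE eqxx !orbT].
- move=> a b p q ap pb bq; rewrite !mem_rcons !inE.
  move=> /orP[/eqP[E1 E2]|ab] /orP[/eqP[E3 E4]|cd]; subst; try lia.
  + have zc : z \in [:: x, y, z & c] by rewrite !inE eqxx !orbT.
    by have := vis _ _ _ cd zc; lia.
  + by case: (edg _ _ ab); lia.
  exact: nc ab cd.
- move=> a b u; rewrite mem_rcons inE => /orP[/eqP[-> ->]|ab]; last by move/sub/(vis _ _ _ ab).
  by rewrite !inE => /or3P[/eqP->|/eqP->|/lt_c]; lia.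
- move=> u xu uc; have [Eu|ne] := eqVneq u y.
    by exists x, z; rewrite mem_rcons mem_head Eu xy yz.
  have [|a [b [ab aub]]] := cov _ xu.
    by move: uc ne; rewrite !inE; case: (u == y); rewrite ?orbF.
  by exists a, b; rewrite mem_rcons inE ab orbT.
- move=> a b xa ab bn; case: (mx a b xa ab bn) => [h|[p [q [pq H]]]|[ac bc]].
  + by constructor 1; rewrite mem_rcons inE h orbT.
  + by constructor 2; exists p, q; rewrite mem_rcons inE pq orbT.
  + have [Ea|nea] := eqVneq a y.
      subst a; move: bc; rewrite !inE => /or4P[/eqP?|/eqP?|/eqP->|/lt_c zb]; try lia.
        by constructor 1; rewrite mem_rcons inE Eyz orbT.
      (* An edge from [y] to a chain vertex beyond [z] crosses the new edge x z. *)
      constructor 2; exists x, z; rewrite mem_rcons mem_head; split=> //.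
      by rewrite /interleaved; lia.
    have [Eb|neb] := eqVneq b y.
      subst b; move: ac; rewrite !inE => /or4P[/eqP->|/eqP?|/eqP?|/lt_c za]; try lia.
      by constructor 1; rewrite mem_rcons inE Exy orbT.
    constructor 3; move: ac bc nea neb; rewrite !inE.
    by case: (a == y) => //; case: (b == y).
- rewrite rcons_uniq un andbT; apply/negP => xz.
  by have := vis _ _ y xz; rewrite !inE eqxx orbT; move/(_ isT); lia.
Qed.

(** * From Dyck words to triangulations *)

Section ChainOfWord.
Variables (n : nat) (w : nat -> bool).

Lemma head_chain v : head 0 (chain n w v) = n - ups w v.
Proof. by elim: v => /= [|v IH]; [lia|case: (w v) => /=; rewrite IH; lia]. Qed.

(** The chain is always two longer than the stack, so a closing letter finds a second vertex to
    delete and a third one behind it. *)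
Lemma size_chain N v : (forall u, u <= N -> u <= (ups w u).*2) -> v <= N ->
  size (chain n w v) + v = (ups w v).*2.+2.
Proof.
move=> H; elim: v => //= v IH lt_v; have := IH (ltnW lt_v); have := H _ lt_v => /=.
by case: (w v) => /=; rewrite ?size_drop; lia.
Qed.

Lemma chain_edges_S v :
  chain_edges n w v.+1 = rcons (chain_edges n w v) (chain_edge n w v.+1).
Proof. exact: mkseqS. Qed.

Hypothesis dw : dyck n w.

Lemma triangulated_chain v : v <= 2 * n ->
  triangulated n (chain n w v) (chain_edges n w v).
Proof.
elim: v => [_|v IH lt_v]; first exact: triangulated_base.
have {}IH := IH (ltnW lt_v); rewrite chain_edges_S /chain_edge /=.
have hd := head_chain v; have sz := size_chain dw.1 (ltnW lt_v).
have ub := dw.1 _ (ltnW lt_v).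
have := dyck_ups_le dw lt_v; have := dw.1 _ lt_v; rewrite /=.
case: (chain n w v) IH hd sz => [|x [|y c]] IH /= hd sz; first by lia.
  by lia.
case: (w v) => le1 le2 /=.
  case: x IH hd => [|x] IH hd; first by lia.
  by have := triangulated_push IH.
case: c IH sz => [|z c] IH /= sz; first by lia.
exact: triangulated_pop IH.
Qed.

Lemma chain_end : chain n w (2 * n) = [:: 0; n.+1].
Proof.
have hd := head_chain (2 * n); have sz := size_chain dw.1 (leqnn _).
have [pth top edg _ _ cov _ _] := triangulated_chain (leqnn _).
rewrite dw.2 subnn in hd; rewrite dw.2 in sz.
case: (chain n w (2 * n)) hd sz pth top edg cov => [|x [|y [|z c]]] /= hd sz pth top edg cov; try lia.
subst x; congr [:: _; _]; have yn := top y; rewrite !inE eqxx orbT in yn.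
have := yn isT; rewrite leq_eqVlt => /orP[/eqP//|lt_y].
(* If n+1 were off the chain, it would be covered by an edge ending beyond it. *)
have [||a [b [/edg[_ _ bn] lt_b]]] := cov n.+1; rewrite ?inE; lia.
Qed.

Lemma chain_edges_noncrossing :
  noncrossing_rel (fun a b => (a, b) \in chain_edges n w (2 * n)).
Proof. exact: tr_noncrossing (triangulated_chain (leqnn _)). Qed.

Lemma chain_edges_maximal :
  maximal_rel n.+2 (fun a b => (a, b) \in chain_edges n w (2 * n)).
Proof.
move=> a b ab bn free.
have tr := triangulated_chain (leqnn _); have pth := tr_path tr.
have := tr_maximal tr; rewrite !chain_end /= in pth *.
move=> /(_ a b isT ab bn)[//|[p [q [pq H]]]|[]].
  by have := free p q _ pq; rewrite H; case: (tr_edge tr pq) => _ -> _ /(_ isT).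
(* The final chain leaves only the pair 0, n+1 undecided, and its two vertices are joined by an
   edge. *)
rewrite !inE => /orP[] /eqP Ea /orP[] /eqP Eb; subst; try lia.
by move: pth; rewrite andbT.
Qed.

Lemma chain_edges_uniq : uniq (chain_edges n w (2 * n)).
Proof. exact: tr_uniq (triangulated_chain (leqnn _)). Qed.

Lemma chain_edges_lt p : p \in chain_edges n w (2 * n) -> p.1 < p.2 /\ p.2 < n.+2.
Proof. by case: p => a b /(tr_edge (triangulated_chain (leqnn _)))[]. Qed.

(* Heads of chains never increase, and a closing letter keeps the head; so the
   letter at v is read off the number of edges still to come at the head. *)
Definition degree_from v i : nat :=
  count (fun u => n - ups w u == i) (iota v ((2 * n).+1 - v)).

Lemma degree_fromS v i : v <= 2 * n ->
  degree_from v i = (n - ups w v == i) + degree_from v.+1 i.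
Proof. by move=> le_v; rewrite /degree_from subSS subSn. Qed.

Lemma degree_from_word v : v < 2 * n ->
  (1 < degree_from v (n - ups w v)) = ~~ w v.
Proof.
move=> lt_v; rewrite (degree_fromS _ (ltnW lt_v)) eqxx.
have := dyck_ups_le dw lt_v; rewrite /=; case E: (w v) => le_n /=.
  rewrite (_ : degree_from _ _ = 0) //; apply/eqP; rewrite -leqn0 leqNgt -has_count.
  apply/hasPn => u; rewrite mem_iota => /andP[vu _].
  have := ups_mono w vu; rewrite /= E; lia.
by rewrite degree_fromS //= E addn0 eqxx.
Qed.

(** The smaller endpoint of the edge output at time [u] is the head of the chain then, so these
    numbers can be read off an unordered list of edges. *)
Lemma degree_from0 i :
  degree_from 0 i = count (fun p => minn p.1 p.2 == i) (chain_edges n w (2 * n)).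
Proof.
rewrite /degree_from subn0 /chain_edges /mkseq count_map.
apply: eq_in_count => u; rewrite mem_iota add0n => /andP[_ lt_u] /=.
have [lt _] : (chain_edge n w u).1 < (chain_edge n w u).2 /\ (chain_edge n w u).2 < n.+2.
  by apply: chain_edges_lt; apply/mapP; exists u; rewrite ?mem_iota.
by rewrite (minn_idPl (ltnW lt)) /chain_edge /= nth0 head_chain.
Qed.

End ChainOfWord.

(** The counts still to come determine the next letter; removing the current edge leaves the counts
    for the following position. *)
Lemma degree_word_inj n w w' : dyck n w -> dyck n w' ->
  (forall i, degree_from n w 0 i = degree_from n w' 0 i) ->
  forall v, v < 2 * n -> w v = w' v.
Proof.
move=> dw dw' Hd.
have H v : v <= 2 * n -> (forall u, u < v -> w u = w' u) /\
    (forall i, degree_from n w v i = degree_from n w' v i).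
  elim: v => // v IH lt_v; have [Hw {}Hd] := IH (ltnW lt_v).
  have E : w v = w' v.
    by apply: negb_inj; rewrite -(degree_from_word dw) // -(degree_from_word dw') //
       Hd (eq_ups Hw).
  split=> [u|i]; first by rewrite ltnS leq_eqVlt => /orP[/eqP->|/Hw].
  by have := Hd i; rewrite !(degree_fromS _ _ (ltnW lt_v)) (eq_ups Hw) => /addnI.
by move=> v lt_v; case: (H v.+1 lt_v) => Hw _; apply: Hw.
Qed.

(** * From triangulations to Dyck words *)

Section WordOfTriangulation.
Variables (n : nat) (e : rel nat).
Hypothesis nc : noncrossing_rel e.
Hypothesis mx : maximal_rel n.+2 e.
Hypothesis e_lt : forall a b, e a b -> b < n.+2.

Definition greedy_up (c : seq nat) : bool :=
  ~~ ((2 < size c) && e (nth 0 c 0) (nth 0 c 2)).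

Fixpoint greedy_chain v : seq nat :=
  if v is u.+1 then
    let c := greedy_chain u in
    if greedy_up c then (head 0 c).-1 :: c else head 0 c :: drop 2 c
  else [:: n; n.+1].

Definition greedy_word v : bool := greedy_up (greedy_chain v).

Lemma chain_greedy v : chain n greedy_word v = greedy_chain v.
Proof. by elim: v => //= v ->. Qed.

(** By [gr_far] an inner chain vertex has no neighbour beyond the next chain vertex. The head is
    exempt, since its further edges are yet to be output. *)
Record greedy (c : seq nat) : Prop := Greedy {
  gr_path : sorted (fun x y => (x < y) && e x y) c;
  gr_size : 1 < size c;
  gr_last : last 0 c = n.+1;
  gr_far : forall i b, 0 < i -> i.+1 < size c -> e (nth 0 c i) b -> b <= nth 0 c i.+1
}.

(** No label lies strictly between the two, so nothing interleaves with this edge. *)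
Lemma boundary_edge a : a <= n -> e a a.+1.
Proof. by move=> an; apply: mx => // c d; rewrite /interleaved; lia. Qed.

Lemma hull_edge : e 0 n.+1.
Proof. by apply: mx => // c d _ /e_lt; rewrite /interleaved; lia. Qed.

(* An edge crossing x z would cross x y, y z or x b, unless it starts at y; the
   last case is excluded because z is the farthest neighbour of y. *)
Lemma greedy_next x y z c b : greedy [:: x, y, z & c] -> y < b -> e x b -> e x z.
Proof.
move=> [/= /and3P[/andP[xy exy] /andP[yz eyz] pz] _ lst far] yb exb.
have [bz|zb|<-//] := ltngtP b z; first by case: (@nc x b y z).
have zn : z < n.+2 by apply: e_lt eyz.
apply: mx => //; first exact: ltn_trans yz.
move=> p q pq epq; apply/negP => /orP[] /and3P[h1 h2 h3]; last first.
  by apply: (@nc p q x b) => //; lia.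
have [py|yp|Ep] := ltngtP p y.
- by apply: (@nc x y p q) => //; lia.
- exact: (@nc y z p q).
- by subst p; have := far 1 q isT isT epq => /=; lia.
Qed.

(** A neighbour of [x] beyond [y] would force the edge to the third vertex, and the greedy word
    would close. With no third vertex, [y] is n+1. *)
Lemma greedy_up_far x y c b : greedy [:: x, y & c] -> greedy_up [:: x, y & c] ->
  e x b -> b <= y.
Proof.
move=> g up exb; rewrite leqNgt; apply/negP => yb.
case: c g up => [|z c] g; first by have := gr_last g; have := e_lt exb => /=; lia.
by rewrite /greedy_up /= (greedy_next g yb exb).
Qed.

(** The edge from 0 to n+1 makes [y] the last vertex. Hence no opening letter is read at head 0
    before the run is over. *)
Lemma greedy_up_end y c : greedy [:: 0, y & c] -> greedy_up [:: 0, y & c] -> c = [::].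
Proof.
move=> g up; have yn := greedy_up_far g up hull_edge.
case: c g up => // z c g _; have /= /andP[_ p] := gr_path g.
have := @sorted_lt_edge e y (z :: c) p _ (mem_last z c); have := gr_last g => /= ->; lia.
Qed.

Lemma greedy_push x y c : 0 < x -> greedy [:: x, y & c] ->
  greedy_up [:: x, y & c] -> greedy [:: x.-1, x, y & c].
Proof.
move=> x0 g up; have [pth _ lst far] := g; split=> //.
  have xn : x <= n by move: (pth) => /= /andP[/andP[xy /e_lt yn] _]; lia.
  rewrite /= in pth *; rewrite pth andbT prednK // leqnn /=.
  by have := @boundary_edge x.-1; rewrite prednK //; apply; lia.
case=> [|[|i]] b // _; last by move=> /= lt_i; apply: (far i.+1).
by move=> _ /=; apply: greedy_up_far g up.
Qed.

Lemma greedy_pop x y z c : greedy [:: x, y, z & c] -> e x z -> greedy [:: x, z & c].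
Proof.
move=> [pth sz lst far] xz; split=> //.
  move: pth => /= /and3P[/andP[xy _] /andP[yz _] ->].
  by rewrite xz (ltn_trans xy yz).
by case=> // i b _ lt_i; apply: (far i.+2).
Qed.

Lemma greedy_run v : v <= 2 * n ->
  [/\ greedy (greedy_chain v),
      size (greedy_chain v) + v = (ups greedy_word v).*2.+2 & ups greedy_word v <= n].
Proof.
elim: v => [_|v IH lt_v].
  split=> //; split=> //; first by rewrite /= ltnSn boundary_edge.
  by case=> [|[]].
have {IH}[g sz up] := IH (ltnW lt_v).
have hd := head_chain n greedy_word v; rewrite chain_greedy in hd.
rewrite /= /greedy_word -/(greedy_word).
case: (greedy_chain v) g sz hd => [|x [|y c]] g /= sz hd; try by have := gr_size g.
case: ifPn => gu.
  (* At head 0 all [n] openings are spent and the chain has two vertices, so its size would give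
     [v = 2 * n]. *)
  have x0 : 0 < x.
    rewrite lt0n; apply/eqP => x0; rewrite {}x0 in g gu hd.
    by have := greedy_up_end g gu => c0; subst c; move: sz => /=; lia.
  by split; [apply: greedy_push|move=> /=; lia|lia].
move: gu; rewrite negbK => /andP[/=]; case: c g sz => [//|z c] g sz _ xz.
by rewrite drop0; split; [apply: greedy_pop g xz|move: sz => /=; lia|lia].
Qed.

(** The chain keeps at least two vertices, which by the size identity is the prefix condition. *)
Lemma dyck_greedy : dyck n greedy_word.
Proof.
split=> [v /greedy_run[/gr_size]|]; first by lia.
have [/gr_size] := greedy_run (leqnn _); lia.
Qed.

(** Each output edge joins adjacent chain vertices and so lies in [e]. The output is already maximal
    and [e] has no crossings, so no edge of [e] is missed. *)
Lemma mem_chain_edges_greedy a b : a < b ->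
  ((a, b) \in chain_edges n greedy_word (2 * n)) = e a b.
Proof.
have sub p q : (p, q) \in chain_edges n greedy_word (2 * n) -> e p q.
  move=> /mapP[u]; rewrite mem_iota add0n => /andP[_ lt_u] [-> ->].
  rewrite chain_greedy; have [[pth sz _ _] _ _] := greedy_run lt_u.
  by case: (greedy_chain u) pth sz => [|x [|y c]] //= /andP[/andP[]].
move=> ab; apply/idP/idP => [/sub//|eab].
apply: (chain_edges_maximal dyck_greedy) => //; first exact: e_lt eab.
move=> p q pq /sub epq; apply/negP => /orP[] /and3P[? ? ?].
  exact: nc eab epq.
exact: nc epq eab.
Qed.

End WordOfTriangulation.

(** * Programs *)

Fixpoint loopfree (p : program) : bool :=
  match p with
  | Seq p q | IfLt _ _ p q => loopfree p && loopfree q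
  | WhileLt _ _ _ => false
  | _ => true
  end.

(** A functional semantics of loop-free programs, by which the invariants are checked by
    computation; the value on a loop is a dummy. *)
Fixpoint run (p : program) (st : state) : state :=
  match p with
  | Skip | WhileLt _ _ _ => st
  | Const r k => set_reg st r k
  | Copy r s => set_reg st r (reg st s)
  | Succ r => set_reg st r (reg st r).+1
  | Pred r => set_reg st r (reg st r).-1
  | Read r a s => set_reg st r (arr st a (reg st s))
  | Write a s r => set_arr st a (reg st s) (reg st r)
  | Seq p q => run q (run p st)
  | IfLt r s p q => if reg st r < reg st s then run p st else run q st
  end.

Fixpoint steps (p : program) : nat :=
  match p with
  | Seq p q => steps p + steps q
  | IfLt _ _ p q => (maxn (steps p) (steps q)).+1
  | _ => 1
  end.

Lemma exec_run p st : loopfree p -> exists2 t, t <= steps p & exec p st t (run p st).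
Proof.
elim: p st => //=; do ?[by move=> *; exists 1 => //; constructor].
- move=> p IHp q IHq st /andP[/(IHp st)[t t_le Ht] /(IHq (run p st))[t' t'_le Ht']].
  by exists (t + t'); [rewrite leq_add|apply: exec_Seq Ht Ht'].
- move=> r s p IHp q IHq st /andP[/(IHp st)[t t_le Ht] /(IHq st)[t' t'_le Ht']].
  case: ltnP => rs.
    by exists t.+1; [rewrite ltnS leq_max t_le|apply: exec_IfLt_true].
  by exists t'.+1; [rewrite ltnS leq_max t'_le orbT|apply: exec_IfLt_false].
Qed.

(** [I k] is the invariant after [k] rounds. Each of the [N] rounds pays for the body and one test;
    the failing test adds 1. *)
Lemma exec_while r s p (I : nat -> state -> Prop) N st : loopfree p -> I 0 st ->
  (forall k st, k < N -> I k st -> reg st r < reg st s /\ I k.+1 (run p st)) ->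
  (forall st, I N st -> reg st s <= reg st r) ->
  exists t st', [/\ exec (WhileLt r s p) st t st', t <= N * (steps p).+1 + 1 & I N st'].
Proof.
move=> lf I0 step stop; suff H d k st1 : k + d = N -> I k st1 ->
    exists t st', [/\ exec (WhileLt r s p) st1 t st', t <= d * (steps p).+1 + 1 & I N st'].
  exact: H I0.
elim: d k st1 => [|d IH] k st1 kd Ik.
  exists 1, st1; move: kd Ik; rewrite addn0 => -> IN; split=> //.
  by apply: exec_WhileLt_false; apply: stop.
have [lt_rs Ik1] := step k st1 ltac:(lia) Ik.
have [t [st' [ex t_le IN]]] := IH k.+1 _ ltac:(lia) Ik1.
have [t1 t1_le ex1] := exec_run st1 lf.
exists (t1 + t).+1, st'; split=> //; last by rewrite mulSn; lia.
exact: exec_WhileLt_true ex1 ex.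
Qed.

(** The head of [s] is the top of the stack, in cell [sp]; deeper entries have smaller indices. *)
Definition stack_at (f : nat -> nat) (sp : nat) (s : seq nat) : Prop :=
  forall i, i < size s -> f (sp - i) = nth 0 s i.

Lemma stack_at_push f g sp s x : stack_at f sp s -> g sp.+1 = x ->
  (forall i, i <= sp -> g i = f i) -> stack_at g sp.+1 (x :: s).
Proof.
move=> fs gx gf [|i] //= lt_i; rewrite subSS gf ?leq_subr //; exact: fs.
Qed.

Lemma stack_at_pop f sp s : stack_at f sp s -> stack_at f sp.-1 (behead s).
Proof.
move=> fs i; rewrite size_behead nth_behead => lt_i.
by rewrite -fs; [congr f|]; lia.
Qed.

(* Register 2 counts the edges read, 3 ends up as 2n, 6 holds the head of the
   chain, 7 the stack pointer, 8 the position in the word and 4, 5, 9 temporary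
   values; array 2 holds the partner of each point and array 3 the tail of the
   chain. *)
Definition read_matching : program :=
  WhileLt 2 1
    (Seq (Read 4 0 2) (Seq (Read 5 1 2) (Seq (Write 2 4 5) (Seq (Write 2 5 4)
    (Seq (Succ 2) (Seq (Succ 3) (Succ 3))))))).

Definition init_chain : program :=
  Seq (Copy 6 0) (Seq (Copy 9 0) (Seq (Succ 9) (Seq (Write 3 7 9)
  (Seq (Write 0 8 6) (Write 1 8 9))))).

Definition run_chain : program :=
  WhileLt 8 3
    (Seq (Read 9 2 8)
    (Seq (IfLt 8 9 (Seq (Succ 7) (Seq (Write 3 7 6) (Pred 6))) (Pred 7))
    (Seq (Succ 8) (Seq (Read 9 3 7) (Seq (Write 0 8 6) (Write 1 8 9)))))).

Definition to_tri : program :=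
  Seq read_matching (Seq init_chain (Seq run_chain (Seq (Copy 1 3) (Succ 1)))).

Section Input.
Variables (m n : nat) (s : seq ('I_m * 'I_m)).

Definition nat_pairs : seq (nat * nat) := [seq (val p.1, val p.2) | p <- s].

Lemma input_arr0 k : arr (input_state n s) 0 k = (nth (0, 0) nat_pairs k).1.
Proof. by rewrite /= /nat_pairs; elim: s k => [|p l IH] [|k] //=; apply: IH. Qed.

Lemma input_arr1 k : arr (input_state n s) 1 k = (nth (0, 0) nat_pairs k).2.
Proof. by rewrite /= /nat_pairs; elim: s k => [|p l IH] [|k] //=; apply: IH. Qed.

End Input.

(** * Running the program from matchings to triangulations *)

Section ToTri.
Variables (n : nat) (s : seq ('I_(2 * n) * 'I_(2 * n))) (e : rel nat).
Variable w : nat -> bool.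
Hypothesis sz : size s = n.
Hypothesis eC : forall a b, e a b = e b a.
Hypothesis es : forall a b, (a, b) \in nat_pairs s -> e a b.
Hypothesis cover : forall v, v < 2 * n ->
  exists b, (v, b) \in nat_pairs s \/ (b, v) \in nat_pairs s.
Hypothesis dw : dyck n w.
Hypothesis we : forall v b, v < 2 * n -> e v b -> w v = (v < b).

Let a_ k := (nth (0, 0) (nat_pairs s) k).1.
Let b_ k := (nth (0, 0) (nat_pairs s) k).2.

Definition read_matching_inv k st : Prop :=
  [/\ [/\ reg st 0 = n, reg st 1 = n, reg st 2 = k, reg st 3 = 2 * k &
          reg st 7 = 0 /\ reg st 8 = 0],
      forall i, arr st 0 i = a_ i, forall i, arr st 1 i = b_ i &
      forall i, i < k -> e (a_ i) (arr st 2 (a_ i)) /\ e (b_ i) (arr st 2 (b_ i))].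

Lemma read_matching_exec : exists t st',
  [/\ exec read_matching (input_state n s) t st', t <= n * 8 + 1 &
      read_matching_inv n st'].
Proof.
apply: (exec_while (I := read_matching_inv)) => //.
- by split=> //; [exact: input_arr0|exact: input_arr1].
- move=> k st lt_k [[r0 r1 r2 r3 [r7 r8]] A0 A1 A2].
  split; first by rewrite r1 r2.
  split=> //=; rewrite ?r0 ?r1 ?r2 ?r3 ?r7 ?r8; first by split=> //; lia.
  have ek : e (a_ k) (b_ k).
    by apply: es; rewrite /a_ /b_ -surjective_pairing mem_nth // size_map sz.
  have ek' : e (b_ k) (a_ k) by rewrite eC.
  (* A cell overwritten in this round again holds a label adjacent to its index, which is all the
     invariant asks. *)
  move=> i; rewrite ltnS leq_eqVlt A0 A1 => /orP[/eqP->|/A2[e1 e2]].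
    by rewrite !eqxx; split=> //; case: eqP => [E|//]; rewrite {2}E.
  by split; do 2![case: eqP => [->//|_]].
- by move=> st [[_ -> -> _ _] _ _ _].
Qed.

(** The input has been consumed by now, so arrays 0 and 1 are reused for the output. *)
Definition chain_inv v st : Prop :=
  [/\ reg st 3 = 2 * n /\ reg st 8 = v,
      forall x, x < 2 * n -> e x (arr st 2 x),
      reg st 6 = head 0 (chain n w v),
      stack_at (arr st 3) (reg st 7) (behead (chain n w v)) &
      forall u, u <= v -> (arr st 0 u, arr st 1 u) = chain_edge n w u].

Lemma init_chain_inv st : read_matching_inv n st -> chain_inv 0 (run init_chain st).
Proof.
move=> [[r0 r1 r2 r3 [r7 r8]] A0 A1 A2]; split=> //=; rewrite ?r0 ?r7 ?r8 //.
- move=> x /cover[b [] xb]; have := xb; rewrite -index_mem size_map sz => /A2[];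
  by rewrite /a_ /b_ nth_index.
- by case.
- by case.
Qed.

Lemma run_chain_exec st : chain_inv 0 st -> exists t st',
  [/\ exec run_chain st t st', t <= 2 * n * 10 + 1 & chain_inv (2 * n) st'].
Proof.
move=> I0; apply: (exec_while (I := chain_inv)) => // [v {I0}st lt_v|{I0}st [[-> ->]] //].
move=> [[r3 r8] A2 r6 stk out]; split; first by rewrite r3 r8.
have sc := size_chain n dw.1 (ltnW lt_v).
have szv := dw.1 _ lt_v; have szv0 := dw.1 _ (ltnW lt_v); rewrite /= in szv.
(* The branch of the program compares [v] with its stored partner, which is exactly the letter at
   [v]. *)
have wv := we lt_v (A2 _ lt_v).
case Ec: (chain n w v) sc stk r6 => [|x [|y c]] sc stk r6; try by move: sc => /=; lia.
rewrite /= in stk r6.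
rewrite /= r8 -wv; case: ifP => wv'; split=> //=; rewrite ?r8 ?r6 ?Ec ?wv' //=.
- apply: stack_at_push stk _ _; first by rewrite /= eqxx.
  by move=> i lt_i; rewrite /= ltn_eqF.
- move=> u; rewrite leq_eqVlt => /orP[/eqP->|lt_u]; last by rewrite ltn_eqF // out.
  by rewrite /chain_edge /= Ec wv' !eqxx.
- by rewrite drop0; apply: stack_at_pop stk.
- move=> u; rewrite leq_eqVlt => /orP[/eqP->|lt_u]; last by rewrite ltn_eqF // out.
  rewrite /chain_edge /= Ec wv' !eqxx /=; congr (_, _).
  rewrite drop0; have := stack_at_pop stk (i := 0); rewrite subn0 => -> //=.
  by rewrite wv' in szv; move: sc => /=; lia.
Qed.

Lemma to_tri_exec : 0 < n -> exists t st',
  [/\ exec to_tri (input_state n s) t st', t <= 100 * n,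
      reg st' 1 = (2 * n).+1 &
      forall u, u <= 2 * n -> (arr st' 0 u, arr st' 1 u) = chain_edge n w u].
Proof.
move=> n0; have [t1 [st1 [ex1 t1_le I1]]] := read_matching_exec.
have [t2 t2_le ex2] := @exec_run init_chain st1 isT.
have [t3 [st3 [ex3 t3_le I3]]] := run_chain_exec (init_chain_inv I1).
have [t4 t4_le ex4] := @exec_run (Seq (Copy 1 3) (Succ 1)) st3 isT.
exists (t1 + (t2 + (t3 + t4))); eexists; split.
- exact: exec_Seq ex1 (exec_Seq ex2 (exec_Seq ex3 ex4)).
(* The total is at most 28n + 10, and [0 < n] absorbs the constant. *)
- by move: t2_le t4_le => /=; lia.
- by case: I3 => -[/= -> _].
- by case: I3.
Qed.

End ToTri.

(* As above, except that 10 counts the pairs written, 11 holds the constant 1,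
   array 2 counts, for each point, the edges still to come of which it is the
   smaller endpoint, and array 3 holds the stack of open positions. *)
Definition read_degrees : program :=
  WhileLt 2 1
    (Seq (Read 4 0 2) (Seq (Read 5 1 2) (Seq (IfLt 4 5 Skip (Copy 4 5))
    (Seq (Read 5 2 4) (Seq (Succ 5) (Seq (Write 2 4 5) (Succ 2))))))).

Definition init_stack : program :=
  Seq (Copy 3 1) (Seq (Pred 3) (Seq (Copy 6 0) (Const 11 1))).

Definition run_stack : program :=
  WhileLt 8 3
    (Seq (Read 9 2 6)
    (Seq (IfLt 11 9
            (Seq (Pred 9) (Seq (Write 2 6 9) (Seq (Read 9 3 7) (Seq (Pred 7)
            (Seq (Write 0 10 9) (Seq (Write 1 10 8) (Succ 10)))))))
            (Seq (Succ 7) (Seq (Write 3 7 8) (Pred 6))))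
         (Succ 8))).

Definition to_match : program :=
  Seq read_degrees (Seq init_stack (Seq run_stack (Copy 1 10))).

(** * Running the program from triangulations to matchings *)

Section ToMatch.
Variables (m n : nat) (s : seq ('I_m * 'I_m)) (w : nat -> bool).
Hypothesis sz : size s = (2 * n).+1.
Hypothesis dw : dyck n w.
Hypothesis ds : forall i : nat,
  count (fun p => minn p.1 p.2 == i) (nat_pairs s) = degree_from n w 0 i.

Let a_ k := (nth (0, 0) (nat_pairs s) k).1.
Let b_ k := (nth (0, 0) (nat_pairs s) k).2.
Let count_upto k (i : nat) := count (fun p => minn p.1 p.2 == i) (take k (nat_pairs s)).

Definition read_degrees_inv k st : Prop :=
  [/\ [/\ reg st 0 = n, reg st 1 = (2 * n).+1 & reg st 2 = k],
      [/\ reg st 7 = 0, reg st 8 = 0 & reg st 10 = 0],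
      forall i, arr st 0 i = a_ i, forall i, arr st 1 i = b_ i &
      forall i, arr st 2 i = count_upto k i].

Lemma read_degrees_exec : exists t st',
  [/\ exec read_degrees (input_state n s) t st', t <= (2 * n).+1 * 9 + 1 &
      read_degrees_inv (2 * n).+1 st'].
Proof.
apply: (exec_while (I := read_degrees_inv)) => //.
- split=> //; [exact: input_arr0|exact: input_arr1|].
  by move=> i; rewrite /count_upto take0.
- move=> k st lt_k [[r0 r1 r2] [r7 r8 r10] A0 A1 A2].
  split; first by rewrite r1 r2.
  have cS i : count_upto k.+1 i = count_upto k i + (minn (a_ k) (b_ k) == i).
    rewrite /count_upto (take_nth (0, 0)) ?size_map ?sz // -cats1 count_cat /=.
    by rewrite addn0.
  rewrite /= r2 A0 A1; have [ab|ba] := ltnP (a_ k) (b_ k).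
    split=> //=; rewrite ?r2 // => i; rewrite cS (minn_idPl (ltnW ab)) !A2 eq_sym.
    by case: eqP => [->|_]; lia.
  split=> //=; rewrite ?r2 // => i; rewrite cS (minn_idPr ba) !A2 eq_sym.
  by case: eqP => [->|_]; lia.
- by move=> st [[_ -> ->] _ _ _ _].
Qed.

(** The counters are tracked only up to the current head. An opening letter leaves the counter of
    the old head undiminished, but the head never returns there. *)
Definition stack_inv v st : Prop :=
  [/\ [/\ reg st 3 = 2 * n, reg st 8 = v, reg st 11 = 1 & reg st 6 = n - ups w v],
      forall i, i <= n - ups w v -> arr st 2 i = degree_from n w v i,
      stack_at (arr st 3) (reg st 7) (stack w v),
      reg st 10 = size (pairs w v) &
      mkseq (fun k => (arr st 0 k, arr st 1 k)) (size (pairs w v)) = pairs w v].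

Lemma init_stack_inv st :
  read_degrees_inv (2 * n).+1 st -> stack_inv 0 (run init_stack st).
Proof.
move=> [[r0 r1 r2] [r7 r8 r10] A0 A1 A2].
split=> //=; rewrite ?r0 ?r1 ?r8 ?subn0 // => i _.
by rewrite A2 /count_upto take_oversize ?ds // size_map sz.
Qed.

Lemma run_stack_exec st : stack_inv 0 st -> exists t st',
  [/\ exec run_stack st t st', t <= 2 * n * 11 + 1 & stack_inv (2 * n) st'].
Proof.
move=> I0; apply: (exec_while (I := stack_inv)) => // [v {I0}st lt_v|{I0}st [[-> -> _ _]] //].
move=> [[r3 r8 r11 r6] A2 stk r10 out]; split; first by rewrite r3 r8.
have szv := dw.1 _ lt_v; have ss := size_stack dw.1 (ltnW lt_v); rewrite /= in szv.
have le_n := dyck_ups_le dw lt_v; rewrite /= in le_n.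
rewrite /= r6 r11 A2 // degree_from_word //.
have dS i := degree_fromS w i (ltnW lt_v).
case: ifPn; rewrite ?negbK => wv; rewrite ?(negbTE wv) ?wv in szv le_n.
- split=> //=; rewrite ?r3 ?r8 ?r11 ?r6 ?r10 ?(negbTE wv) ?addn0 ?size_rcons //.
  + move=> i le_i; rewrite A2 // dS; case: eqP => [->|ne]; rewrite ?eqxx //.
    by rewrite dS; case: eqP => // ?; case: ne.
  + exact: stack_at_pop stk.
  + rewrite mkseqS; congr rcons; last first.
      rewrite eqxx; congr (_, _).
      have := stk 0; rewrite subn0 nth0 => -> //; lia.
    rewrite -[RHS]out; apply/eq_in_map => i; rewrite mem_iota => /andP[_ lt_i].
    by rewrite ltn_eqF.
- split=> //=; rewrite ?r3 ?r8 ?r11 ?r6 ?r10 ?wv //.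
  + by split=> //; lia.
  + move=> i le_i; rewrite A2; last by lia.
    by rewrite dS; case: eqP => //; lia.
  + apply: stack_at_push stk _ _; first by rewrite /= eqxx.
    by move=> i lt_i; rewrite /= ltn_eqF.
Qed.

Lemma to_match_exec : 0 < n -> exists t st',
  [/\ exec to_match (input_state n s) t st', t <= 100 * n &
      mkseq (fun k => (arr st' 0 k, arr st' 1 k)) (reg st' 1) = pairs w (2 * n)].
Proof.
move=> n0; have [t1 [st1 [ex1 t1_le I1]]] := read_degrees_exec.
have [t2 t2_le ex2] := @exec_run init_stack st1 isT.
have [t3 [st3 [ex3 t3_le I3]]] := run_stack_exec (init_stack_inv I1).
have [t4 t4_le ex4] := @exec_run (Copy 1 10) st3 isT.
exists (t1 + (t2 + (t3 + t4))); eexists; split.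
- exact: exec_Seq ex1 (exec_Seq ex2 (exec_Seq ex3 ex4)).
(* Here the total is at most 40n + 16. *)
- by move: t2_le t4_le => /=; lia.
- by case: I3 => _ _ _ /= ->.
Qed.

End ToMatch.

(** * The bijection *)

Section Matchings.
Variables (R : realType) (n : nat) (V : 'I_(2 * n) -> 'rV[R]_2).
Hypothesis cw : clockwise V.
Implicit Types M : {set {set 'I_(2 * n)}}.

Definition word_of M (v : nat) : bool :=
  [exists b : 'I_(2 * n), (v < b) && adj M v b].

Lemma word_ofP M v : reflect (exists2 b, v < b & adj M v b) (word_of M v).
Proof.
apply: (iffP existsP) => [[b /andP[? ?]]|[b vb ab]]; first by exists b.
by exists (Ordinal (adj_lt ab).2); rewrite vb ab.
Qed.

Lemma plane_matching_rel M : plane_perfect_matching V M ->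
  matching_rel (2 * n) (adj M) /\ noncrossing_rel (adj M).
Proof.
move=> [sM _ /(noncrossingP cw sM) nc pM]; split=> //; split.
- exact: adjC.
- by move=> a b ab; split; [apply: adj_neq ab|case: (adj_lt ab)].
- move=> a an; have [e [[eM ae] _]] := pM (Ordinal an).
  have [i [j [_ E]]] := segments_edge sM eM; subst e.
  move: ae; rewrite !inE => /orP[] /eqP /(congr1 val) /= ->.
    by exists j; rewrite adj_ord.
  by exists i; rewrite adjC adj_ord.
- move=> a b b' /adjP[i [j [<- <- ij]]] /adjP[k [l [/val_inj-> <- il]]].
  have [e [_ ue]] := pM i.
  have := ue _ (conj ij (set21 _ _)); rewrite (ue _ (conj il (set21 _ _))).
  by move=> /set2_eq[[_ ->]|[-> ->]].
Qed.

Lemma dyck_word_of M : plane_perfect_matching V M -> dyck n (word_of M).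
Proof.
move=> /plane_matching_rel[em nc].
by apply: (dyck_word_of_matching em nc) => v _; apply: word_ofP.
Qed.

Lemma mem_pairs_word_of M a b : plane_perfect_matching V M -> a < b ->
  ((a, b) \in pairs (word_of M) (2 * n)) = adj M a b.
Proof.
move=> /plane_matching_rel[em nc] ab.
by apply: (mem_pairs_word_of_matching em nc) => // v _; apply: word_ofP.
Qed.

Definition matching_of (w : nat -> bool) : {set {set 'I_(2 * n)}} :=
  graph_of (2 * n) (fun a b => (a, b) \in pairs w (2 * n)).

Lemma adj_matching_of w a b : dyck n w -> a < b ->
  adj (matching_of w) a b = ((a, b) \in pairs w (2 * n)).
Proof.
move=> dw ab; rewrite adj_graph_of // andbC.
case H: (_ \in _) => //=.
by have [_ ->] := pm_pair (dyck_matching dw (leqnn _)) H.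
Qed.

(** The final stack is empty, so each position is in a pair, and an opening letter can only be its
    left end. *)
Lemma word_of_matching_of w v : dyck n w -> v < 2 * n ->
  word_of (matching_of w) v = w v.
Proof.
move=> dw lt_v; have pm := dyck_matching dw (leqnn _).
apply/word_ofP/idP => [[b vb]|wv].
  by rewrite adj_matching_of // => /(pm_pair pm)[].
have := pm_total pm lt_v; rewrite (dyck_stack_end dw) => -[//|[y [vy|yv]]].
  by exists y; rewrite ?adj_matching_of //; case: (pm_pair pm vy).
by case: (pm_pair pm yv); rewrite wv.
Qed.

Lemma matching_ofP w : dyck n w -> plane_perfect_matching V (matching_of w).
Proof.
move=> dw; have pm := dyck_matching dw (leqnn _).
have sM : segments (matching_of w) by apply: segments_graph_of.
have adjM := adj_matching_of dw.
have lt_p p : p \in pairs w (2 * n) -> p.1 < p.2.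
  by case: p => a b /(pm_pair pm)[].
split=> //.
(* There are as many edges as closing letters, that is 2n - n. *)
- have [s [Es sl]] : exists s, pairs w (2 * n) = nat_pairs s /\ lists s (matching_of w).
    by apply: lists_exists => // [|a b ab]; [apply: pm_uniq pm|rewrite adjM].
  rewrite cardE -(perm_size sl) size_map -(size_map (fun p => (val p.1, val p.2))).
  rewrite -[map _ _]/(nat_pairs s) -Es; have := size_pairs w (2 * n); rewrite dw.2; lia.
- apply/noncrossingP => // a b c d ac cb bd.
  rewrite !adjM; try lia.
  exact: pm_noncrossing pm _ _ _ _ ac cb bd.
(* The letter at [i] tells whether [i] is a left or a right end, so it plays the same role in both
   pairs. *)
- have uniq_e (i : 'I_(2 * n)) (a b c d : nat) : (a, b) \in pairs w (2 * n) ->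
      (c, d) \in pairs w (2 * n) -> (i == a :> nat) || (i == b :> nat) ->
      (i == c :> nat) || (i == d :> nat) -> (a, b) = (c, d).
    move=> ab cd; have [_ _ wa wb] := pm_pair pm ab; have [_ _ wc wd] := pm_pair pm cd.
    move=> /orP[] /eqP-> /orP[] /eqP E; subst.
    + by rewrite (pm_left pm ab cd).
    + by rewrite wa in wd.
    + by rewrite wc in wb.
    + by rewrite (pm_right pm ab cd).
  have edge e i : e \in matching_of w -> i \in e -> exists a b : 'I_(2 * n),
      [/\ e = [set a; b], (val a, val b) \in pairs w (2 * n) &
          (i == a :> nat) || (i == b :> nat)].
    move=> eM; have [a [b [ab E]]] := segments_edge sM eM; subst e.
    rewrite !inE => ie; exists a, b; split=> //.
    by rewrite -adj_ord adjM in eM.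
  move=> i.
  have [e [eM ie]] : exists e, e \in matching_of w /\ i \in e.
    have := pm_total pm (ltn_ord i); rewrite (dyck_stack_end dw) => -[//|[y H]].
    have iy : adj (matching_of w) i y.
      by case: H => H; have := lt_p _ H => /= lt; [|rewrite adjC]; rewrite adjM.
    move/adjP: iy => [k [l [/val_inj-> _ kl]]]; exists [set i; l]; split=> //.
    exact: set21.
  exists e; split=> // e' [e'M ie'].
  have [a [b [-> ab iab]]] := edge _ _ eM ie.
  have [c [d [-> cd icd]]] := edge _ _ e'M ie'.
  by have [/val_inj-> /val_inj->] := uniq_e i _ _ _ _ ab cd iab icd.
Qed.

End Matchings.

(** * Triangulations and their words *)

Section Triangulations.
Variables (R : realType) (n : nat) (P : 'I_(n + 2) -> 'rV[R]_2).
Hypothesis cw : clockwise P.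
Implicit Types (w : nat -> bool).

Definition triangulation_of w : {set {set 'I_(n + 2)}} :=
  graph_of (n + 2) (fun a b => (a, b) \in chain_edges n w (2 * n)).

Lemma adj_triangulation_of w a b : dyck n w -> a < b ->
  adj (triangulation_of w) a b = ((a, b) \in chain_edges n w (2 * n)).
Proof.
move=> dw ab; rewrite adj_graph_of // andbC addn2.
case H: (_ \in _) => //=; by have [_ ->] := chain_edges_lt dw H.
Qed.

Lemma triangulation_ofP w : dyck n w -> triangulation P (triangulation_of w).
Proof.
move=> dw; have adjT := adj_triangulation_of dw.
apply/triangulationP => //; first exact: segments_graph_of.
split=> [a b c d ac cb bd|a b ab bn free].
  rewrite !adjT; try lia.
  exact: chain_edges_noncrossing dw _ _ _ _ ac cb bd.
rewrite adjT //; apply: (chain_edges_maximal dw) => //; first by rewrite -addn2.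
by move=> c d cd cdE; apply: free => //; rewrite adjT.
Qed.

Lemma triangulation_of_lists w : dyck n w -> exists s,
  chain_edges n w (2 * n) = nat_pairs s /\ lists s (triangulation_of w).
Proof.
move=> dw; apply: lists_exists.
- exact: segments_graph_of.
- exact: chain_edges_uniq.
- by move=> p /(chain_edges_lt dw)[].
- by move=> a b ab; rewrite adj_triangulation_of.
Qed.

Lemma degree_lists w s : dyck n w -> lists s (triangulation_of w) ->
  size s = (2 * n).+1 /\ forall i : nat,
  count (fun p => minn p.1 p.2 == i) (nat_pairs s) = degree_from n w 0 i.
Proof.
move=> dw sT; have [s0 [E0 s0T]] := triangulation_of_lists dw; split.
  rewrite /lists perm_sym in s0T.
  have := perm_size (perm_trans sT s0T); rewrite !size_map => ->.
  by rewrite -(size_map (fun p => (val p.1, val p.2))) -[map _ _]/(nat_pairs s0) -E0 size_mkseq.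
move=> i; rewrite degree_from0 // E0 !count_map.
exact: lists_count sT s0T.
Qed.

Lemma triangulation_of_surj T : triangulation P T ->
  exists2 w, dyck n w & T = triangulation_of w.
Proof.
move=> tT; have sT : segments T by case: tT => -[].
have [nc mx'] := (triangulationP cw sT).1 tT.
have mx : maximal_rel n.+2 (adj T) by move=> a b ab; rewrite -addn2; apply: mx'.
have e_lt a b : adj T a b -> b < n.+2 by case/adj_lt; rewrite addn2.
have dw := dyck_greedy nc mx e_lt; exists (greedy_word n (adj T)) => //.
have H a b : a < b -> adj T a b = adj (triangulation_of (greedy_word n (adj T))) a b.
  by move=> ab; rewrite adj_triangulation_of // (mem_chain_edges_greedy nc mx).
apply/eqP; rewrite finset.eqEsubset !sub_adj //; last by move=> a b ab; rewrite H.
  exact: segments_graph_of.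
by move=> a b ab; rewrite H.
Qed.

(** The counts of both words are taken over a listing of the same graph, and they determine the
    letters. *)
Lemma triangulation_of_inj w w' : dyck n w -> dyck n w' ->
  triangulation_of w = triangulation_of w' -> forall v, v < 2 * n -> w v = w' v.
Proof.
move=> dw dw' E; apply: degree_word_inj => // i.
have [s [_ sT]] := triangulation_of_lists dw.
have [_ <-] := degree_lists dw sT.
by rewrite E in sT; have [_ <-] := degree_lists dw' sT.
Qed.

Lemma eq_triangulation_of w w' : (forall v, v < 2 * n -> w v = w' v) ->
  triangulation_of w = triangulation_of w'.
Proof.
move=> H; rewrite /triangulation_of (_ : chain_edges n w _ = chain_edges n w' (2 * n)) //.
apply/eq_in_map => u; rewrite mem_iota add0n => /andP[_ lt_u].
by rewrite /chain_edge (@eq_chain n w w') // => v vu; apply: H; lia.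
Qed.

End Triangulations.

(** * Correctness of the two programs on listings of edges *)

Section Correctness.
Variables (R : realType) (n : nat) (V : 'I_(2 * n) -> 'rV[R]_2).
Hypothesis cw : clockwise V.
Variable M : {set {set 'I_(2 * n)}}.
Hypothesis pM : plane_perfect_matching V M.
Hypothesis n0 : 0 < n.

Lemma to_tri_correct :
  computes_within to_tri n (100 * n) M (triangulation_of n (word_of M)).
Proof.
move=> s sM; have dw := dyck_word_of cw pM.
have [[eC eN eT eF] nc] := plane_matching_rel cw pM.
have [sgM cM _ _] := pM.
have sz : size s = n by rewrite -[RHS]cM cardE -(perm_size sM) size_map.
have [] := @to_tri_exec n s (adj M) (word_of M) sz (adjC M) _ _ dw _ n0.
- move=> a b /mapP[[i j] ij [-> ->]]; rewrite adj_ord -mem_enum -(perm_mem sM).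
  by apply/mapP; exists (i, j).
- move=> v /eT[b vb]; exists b; have [ne _] := eN _ _ vb.
  by apply/orP; rewrite -(lists_adj sM).
- move=> v b lt_v vb; apply/word_ofP/idP => [[b' vb' e']|]; last by exists b.
  by rewrite (eF _ _ _ vb e').
move=> t [st [ex t_le r1 out]]; have [s' [Es' s'T]] := triangulation_of_lists dw.
exists t, st, s'; split=> //; rewrite /stores r1 -[RHS]Es'.
by apply/eq_in_map => u; rewrite mem_iota add0n => /andP[_ lt_u]; apply: out.
Qed.

Lemma to_match_correct :
  computes_within to_match n (100 * n) (triangulation_of n (word_of M)) M.
Proof.
move=> s sT; have dw := dyck_word_of cw pM; have [sz ds] := degree_lists dw sT.
have [t [st [ex t_le out]]] := to_match_exec sz dw ds n0.
have pm := dyck_matching dw (leqnn _).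
have [s' [Es' s'M]] : exists s', pairs (word_of M) (2 * n) = nat_pairs s' /\ lists s' M.
  apply: lists_exists; first by case: pM.
  - exact: pm_uniq pm.
  - by case=> a b /(pm_pair pm)[].
  - by move=> a b ab; apply: mem_pairs_word_of pM ab.
by exists t, st, s'; split=> //; rewrite /stores out.
Qed.

End Correctness.

Theorem theorem1 (R : realType) :
  exists (to_tri to_match : program) (C : nat),
  forall n : nat, (1 <= n)%N ->
  forall (V : 'I_(2 * n) -> 'rV[R]_2) (P : 'I_(n + 2) -> 'rV[R]_2),
    convex_position V -> clockwise V ->
    convex_position P -> clockwise P ->
  exists f : {set {set 'I_(2 * n)}} -> {set {set 'I_(n + 2)}},
    set_bij (plane_perfect_matching V) (triangulation P) f /\
    forall M, plane_perfect_matching V M ->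
      computes_within to_tri n (C * n) M (f M) /\
      computes_within to_match n (C * n) (f M) M.
Proof.
exists to_tri, to_match, 100 => n n0 V P _ cwV _ cwP.
exists (fun M => triangulation_of n (word_of M)); split; last first.
  by move=> M pM; split; [apply: to_tri_correct pM n0|apply: to_match_correct pM n0].
split.
- by move=> M pM; apply: triangulation_ofP => //; apply: dyck_word_of pM.
- move=> M M' /set_mem pM /set_mem pM'.
  (* Equal triangulations give equal words, and the bracket pairs of its word recover a matching. *)
  move=> /(triangulation_of_inj (dyck_word_of cwV pM) (dyck_word_of cwV pM')) E.
  have adjE a b : a < b -> adj M a b = adj M' a b.
    move=> ab; rewrite -(mem_pairs_word_of cwV pM ab) -(mem_pairs_word_of cwV pM' ab).
    by rewrite (eq_pairs E).
  have [[sM _ _ _] [sM' _ _ _]] := (pM, pM').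
  by apply/eqP; rewrite finset.eqEsubset !sub_adj // => a b ab; rewrite adjE.
- move=> T /(triangulation_of_surj cwP)[w dw ->].
  exists (matching_of n w); first exact: matching_ofP.
  (* The two infinite words are known to agree only on their first 2n letters, which are all that
     the triangulation depends on. *)
  by apply: eq_triangulation_of => v lt_v; apply: word_of_matching_of.
Qed.
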